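(* Let $k$ be a field and let $R$ and $S$ be left noetherian $k$-algebras. Then the following hold: (a) If $R$ and $S$ are Morita equivalent, then $R$ satisfies the Dixmier-Moeglin equivalence if and only if $S$ does. (b) If $R$ satisfies the Dixmier-Moeglin equivalence and $e$ is a nonzero idempotent of $R$, then $eRe$ satisfies the Dixmier-Moeglin equivalence. (c) If $R$ and $S$ satisfy the Dixmier-Moeglin equivalence and if $R\otimes_k S$ is left noetherian and satisfies the Nullstellensatz, then $R\otimes_k S$ satisfies the Dixmier-Moeglin equivalence.
   Context: Algebras are associative and unital; $eRe$ is a $k$-algebra with identity $e$. $\mathrm{Spec}(R)$ is the set of (two-sided) prime ideals of $R$ with the Zariski topology, whose closed sets are the sets $\{P : P\supseteq I\}$ for $I$ a two-sided ideal. For a left noetherian $k$-algebra $R$ and $P\in\mathrm{Spec}(R)$: $P$ is locally closed if $\{P\}$ is a locally closed subset of $\mathrm{Spec}(R)$ (equivalently, $P$ is not equal to the intersection of all prime ideals properly containing $P$, where an empty intersection is $R$); $P$ is primitive if it is the annihilator of a simple left $R$-module; $P$ is rational if the centre $Z(Q(R/P))$ of the Goldie ring of quotients $Q(R/P)$ of $R/P$ is an algebraic extension of $k$. The left noetherian $k$-algebra $R$ satisfies the Dixmier-Moeglin equivalence if for every $P\in \mathrm{Spec}(R)$ the three properties ''locally closed'', ''primitive'' and ''rational'' are equivalent. Two rings are Morita equivalent if they have equivalent categories of left modules. A $k$-algebra $T$ satisfies the Nullstellensatz (over $k$) if every prime ideal of $T$ is an intersection of primitive ideals (i.e. $T$ is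 a Jacobson ring) and, for every simple left $T$-module $M$, the endomorphism ring $\mathrm{End}_T(M)$ is algebraic over $k$.
   Formalization: In (a), Morita equivalent means a k-linear equivalence of the categories of left modules; with plain equivalence (a) is false: k = Q(t0,t1,...), R = k, S = the ring k with k acting via t_i -> t_{i+1}. *)

(* Defs.v *)
From HB Require Import structures.
From mathcomp Require Import all_boot all_order all_algebra.
From mathcomp Require Import generic_quotient ring_quotient sesquilinear.
From mathcomp Require Import boolp classical_sets topology.

Set Implicit Arguments.
Unset Strict Implicit.
Unset Printing Implicit Defensive.

Import GRing.Theory.

Local Open Scope classical_set_scope.
Local Open Scope ring_scope.

(* Rings and algebras are associative, unital and nonzero (nzRingType, algType
   of MathComp), but not commutative. *)

Definition submodule (R : pzRingType) (M : lmodType R) (N : set M) : Prop :=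
  N 0 /\ forall (a : R) (u v : M), N u -> N v -> N (a *: u + v).

Definition left_ideal (R : nzRingType) (I : set R) : Prop :=
  @submodule R R^o I.

Definition ideal (R : nzRingType) (I : set R) : Prop :=
  [/\ I 0,
      forall x y, I x -> I y -> I (x + y),
      forall r x, I x -> I (r * x) &
      forall r x, I x -> I (x * r)].

Definition left_noetherian (R : nzRingType) : Prop :=
  forall I : nat -> set R,
    (forall n, left_ideal (I n)) -> (forall n, I n `<=` I n.+1) ->
    exists N, forall n, (N <= n)%N -> I n = I N.

Definition prime_ideal (R : nzRingType) (P : set R) : Prop :=
  [/\ ideal P, P <> setT &
      forall I J : set R, ideal I -> ideal J ->
        (forall x y, I x -> J y -> P (x * y)) -> I `<=` P \/ J `<=` P].

Record spec (R : nzRingType) := Spec {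
  spec_ideal :> set R;
  spec_prime : prime_ideal spec_ideal
}.

HB.instance Definition _ (R : nzRingType) := gen_eqMixin (spec R).
HB.instance Definition _ (R : nzRingType) := gen_choiceMixin (spec R).

Section Zariski.
Variable R : nzRingType.
Implicit Types (I J : set R) (P : spec R) (U : set (spec R)).

Definition zariski_open U : Prop :=
  exists2 I, ideal I & U = [set P | ~ I `<=` P].

Lemma ideal_setT : ideal [set: R]. Proof. by []. Qed.

Lemma ideal_bigcap (T : Type) (D : set T) (F : T -> set R) :
  (forall i, D i -> ideal (F i)) -> ideal (\bigcap_(i in D) F i).
Proof.
move=> FI; split=> [i Di|x y Fx Fy i Di|r x Fx i Di|r x Fx i Di];
  have [I0 ID IM IMr] := FI i Di; first exact: I0.
- by apply: ID; [apply: Fx|apply: Fy].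
- by apply: IM; apply: Fx.
- by apply: IMr; apply: Fx.
Qed.

Lemma ideal_setI I J : ideal I -> ideal J -> ideal (I `&` J).
Proof.
move=> [I0 ID IMl IMr] [J0 JD JMl JMr]; split => // [x y|r x|r x].
- by move=> [? ?] [? ?]; split; [apply: ID|apply: JD].
- by move=> [? ?]; split; [apply: IMl|apply: JMl].
- by move=> [? ?]; split; [apply: IMr|apply: JMr].
Qed.

Lemma zariski_openT : zariski_open setT.
Proof.
exists [set: R]; first exact: ideal_setT.
apply/seteqP; split=> // P _ TP; have [_ + _] := spec_prime P; apply.
by apply/seteqP; split.
Qed.

Lemma zariski_openI : setI_closed zariski_open.
Proof.
move=> _ _ [I iI ->] [J iJ ->]; exists (I `&` J); first exact: ideal_setI.
apply/seteqP; split=> P /=; last first.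
  by move=> h; split=> h'; apply: h => x [? ?]; apply: h'.
move=> [nIP nJP] IJP; have [_ _ pP] := spec_prime P.
suff IJ x y : I x -> J y -> spec_ideal P (x * y) by have [] := pP I J iI iJ IJ.
move=> Ix Jy; apply: IJP.
have [_ _ _ IMr] := iI; have [_ _ JMl _] := iJ.
by split; [apply: IMr|apply: JMl].
Qed.

Lemma zariski_open_bigU (T : Type) (f : T -> set (spec R)) :
  (forall i, zariski_open (f i)) -> zariski_open (\bigcup_i f i).
Proof.
move=> fo.
pose D := [set K | ideal K /\
  forall i I, ideal I -> f i = [set P | ~ I `<=` P] -> I `<=` K].
exists (\bigcap_(K in D) K); first by apply: ideal_bigcap => K [].
apply/seteqP; split=> P /=.
  move=> [i _ fiP] DP; have [I iI fiE] := fo i.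
  move: fiP; rewrite fiE /=; apply=> x Ix; apply: DP => K [_].
  by move=> /(_ i I iI fiE); apply.
move=> nDP; apply: contrapT => nfP; apply: nDP => x; apply; split.
  by have [] := spec_prime P.
move=> i I iI fiE; apply: contrapT => nIP; apply: nfP.
by exists i => //; rewrite fiE.
Qed.

HB.instance Definition _ := isOpenTopological.Build (spec R)
  zariski_openT zariski_openI zariski_open_bigU.

Lemma zariski_closedP (A : set (spec R)) :
  closed A <-> exists2 I, ideal I & A = [set P : spec R | I `<=` P].
Proof.
rewrite -openC; split=> -[I iI AE]; exists I => //.
  rewrite -[A]setCK AE; apply/seteqP; split=> P /=; last by move=> ? h; exact: h.
  by move=> /contrapT.
by rewrite AE.
Qed.

End Zariski.

Definition locally_closed (T : topologicalType) (A : set T) : Prop :=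
  exists U C : set T, [/\ open U, closed C & A = U `&` C].

Definition simple_module (R : nzRingType) (M : lmodType R) : Prop :=
  (exists m : M, m != 0) /\
  forall N : set M, submodule N -> N = [set 0] \/ N = setT.

Definition annihilator (R : nzRingType) (M : lmodType R) : set R :=
  [set r | forall m : M, r *: m = 0].

Definition primitive_ideal (R : nzRingType) (P : set R) : Prop :=
  exists2 M : lmodType R, simple_module M & P = annihilator M.

Section Factor.
Variables (k : fieldType) (R : algType k) (P : spec R).

Definition spec_pred : {pred R} := fun x => `[< spec_ideal P x >].

Lemma spec_zmod_closed : zmod_closed spec_pred.
Proof.
have [[I0 ID IMl _] _ _] := spec_prime P; split; first exact/asboolP.
move=> x y /asboolP Px /asboolP Py; apply/asboolP/ID => //.
by rewrite -mulN1r; exact: IMl.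
Qed.

HB.instance Definition _ := GRing.isZmodClosed.Build R spec_pred
  spec_zmod_closed.

(* R / P. The ring structure that ring_quotient puts on {ideal_quot _} is for
   commutative rings only, so the product is defined below. *)
Definition factor : Type := {ideal_quot spec_pred}.

HB.instance Definition _ := GRing.Zmodule.on factor.

Definition factor_pi (x : R) : factor := (\pi_{ideal_quot spec_pred} x)%qT.

Lemma factor_piP x y : factor_pi x = factor_pi y <-> spec_ideal P (x - y).
Proof.
split=> [/eqP|Pxy]; first by rewrite -Quotient.idealrBE => /asboolP.
by apply/eqP; rewrite -Quotient.idealrBE; apply/asboolP.
Qed.

Lemma factor_pi_surj q : exists x, factor_pi x = q.
Proof. by exists (repr q)%qT; exact: reprK. Qed.

Lemma factor_piB x y : factor_pi (x - y) = factor_pi x - factor_pi y.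
Proof. by rewrite /factor_pi !piE. Qed.

Lemma factor_piD x y : factor_pi (x + y) = factor_pi x + factor_pi y.
Proof. by rewrite /factor_pi !piE. Qed.

Definition factor_one : factor := factor_pi 1.
Definition factor_mul (p q : factor) : factor :=
  factor_pi (repr p * repr q)%qT.
Definition factor_scale (a : k) (q : factor) : factor :=
  factor_pi (a *: repr q)%qT.

Let repr_pi x : spec_ideal P ((repr (factor_pi x))%qT - x).
Proof. by apply/factor_piP; exact: reprK. Qed.

Lemma factor_piM x y : factor_pi (x * y) = factor_mul (factor_pi x) (factor_pi y).
Proof.
apply/esym/factor_piP; have [[_ PD PMl PMr] _ _] := spec_prime P.
set x' := repr _; set y' := repr _.
have -> : x' * y' - x * y = x' * (y' - y) + (x' - x) * y.
  by rewrite mulrBr mulrBl addrA subrK.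
by apply: PD; [apply: PMl|apply: PMr]; exact: repr_pi.
Qed.

Lemma factor_piZ a x : factor_pi (a *: x) = factor_scale a (factor_pi x).
Proof.
apply/esym/factor_piP; have [[_ _ PMl _] _ _] := spec_prime P.
by rewrite -scalerBr -mulr_algl; apply: PMl; exact: repr_pi.
Qed.

Lemma factor_mulA : associative factor_mul.
Proof.
move=> p q r.
have [[x <-] [y <-] [z <-]] := And3 (factor_pi_surj p) (factor_pi_surj q) (factor_pi_surj r).
by rewrite -!factor_piM mulrA.
Qed.

Lemma factor_mul1 : left_id factor_one factor_mul.
Proof. by move=> p; have [x <-] := factor_pi_surj p; rewrite -factor_piM mul1r. Qed.

Lemma factor_mulr1 : right_id factor_one factor_mul.
Proof. by move=> p; have [x <-] := factor_pi_surj p; rewrite -factor_piM mulr1. Qed.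

Lemma factor_mulDl : left_distributive factor_mul +%R.
Proof.
move=> p q r.
have [[x <-] [y <-] [z <-]] := And3 (factor_pi_surj p) (factor_pi_surj q) (factor_pi_surj r).
by rewrite -factor_piD -!factor_piM mulrDl factor_piD.
Qed.

Lemma factor_mulDr : right_distributive factor_mul +%R.
Proof.
move=> p q r.
have [[x <-] [y <-] [z <-]] := And3 (factor_pi_surj p) (factor_pi_surj q) (factor_pi_surj r).
by rewrite -factor_piD -!factor_piM mulrDr factor_piD.
Qed.

Lemma factor_one_neq0 : factor_one != 0.
Proof.
have -> : 0 = factor_pi 0 by rewrite /factor_pi !piE.
apply/eqP => /factor_piP; rewrite subr0 => P1.
have [[_ _ PMl _] + _] := spec_prime P; apply.
by apply/seteqP; split=> // x _; rewrite -[x]mulr1; exact: PMl.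
Qed.

HB.instance Definition _ := GRing.Zmodule_isNzRing.Build factor
  factor_mulA factor_mul1 factor_mulr1 factor_mulDl factor_mulDr factor_one_neq0.

Lemma factor_scaleA a b q :
  factor_scale a (factor_scale b q) = factor_scale (a * b) q.
Proof. by have [x <-] := factor_pi_surj q; rewrite -!factor_piZ scalerA. Qed.

Lemma factor_scale1 : left_id 1 factor_scale.
Proof. by move=> q; have [x <-] := factor_pi_surj q; rewrite -factor_piZ scale1r. Qed.

Lemma factor_scaleDr : right_distributive factor_scale +%R.
Proof.
move=> a p q; have [[x <-] [y <-]] := conj (factor_pi_surj p) (factor_pi_surj q).
by rewrite -factor_piD -!factor_piZ scalerDr factor_piD.
Qed.

Lemma factor_scaleDl q : {morph factor_scale^~ q : a b / a + b}.
Proof.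
move=> a b; have [x <-] := factor_pi_surj q.
by rewrite -!factor_piZ scalerDl factor_piD.
Qed.

HB.instance Definition _ := GRing.Zmodule_isLmodule.Build k factor
  factor_scaleA factor_scale1 factor_scaleDr factor_scaleDl.

Lemma factor_scaleAl (a : k) (p q : factor) : a *: (p * q) = (a *: p) * q.
Proof.
have [[x <-] [y <-]] := conj (factor_pi_surj p) (factor_pi_surj q).
by rewrite -[LHS]/(factor_scale a (factor_mul _ _))
  -[RHS]/(factor_mul (factor_scale a _) _) -!(factor_piM, factor_piZ) scalerAl.
Qed.

HB.instance Definition _ := GRing.Lmodule_isLalgebra.Build k factor
  factor_scaleAl.

Lemma factor_scaleAr (a : k) (p q : factor) : a *: (p * q) = p * (a *: q).
Proof.
have [[x <-] [y <-]] := conj (factor_pi_surj p) (factor_pi_surj q).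
by rewrite -[LHS]/(factor_scale a (factor_mul _ _))
  -[RHS]/(factor_mul _ (factor_scale a _)) -!(factor_piM, factor_piZ) scalerAr.
Qed.

HB.instance Definition _ := GRing.Lalgebra_isAlgebra.Build k factor
  factor_scaleAr.

HB.instance Definition _ := GRing.isZmodMorphism.Build R factor factor_pi
  factor_piB.
HB.instance Definition _ := GRing.isMonoidMorphism.Build R factor factor_pi
  (conj (erefl factor_one) factor_piM).
HB.instance Definition _ := GRing.isScalable.Build k R factor *:%R factor_pi
  factor_piZ.

End Factor.

Definition algebraic_elt (k : fieldType) (A : algType k) (a : A) : Prop :=
  exists2 p : {poly k}, p != 0 & horner_alg a p = 0.

Definition center (A : nzRingType) : set A :=
  [set z | forall a, z * a = a * z].

Definition regular (A : nzRingType) (s : A) : Prop :=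
  GRing.lreg s /\ GRing.rreg s.

(* Q, with the embedding j, is a (left) Goldie ring of quotients of A: regular
   elements of A become units and every element of Q has the form s^-1 a. *)
Definition goldie_quotient_ring (k : fieldType) (A Q : algType k)
    (j : {lrmorphism A -> Q}) : Prop :=
  [/\ injective j,
      forall s, regular s -> exists t, t * j s = 1 /\ j s * t = 1 &
      forall q, exists s a, regular s /\ j s * q = j a].

(* Q(R/P) exists by Goldie's theorem when R is left noetherian, and is unique
   up to isomorphism over R/P. *)
Definition rational (k : fieldType) (R : algType k) (P : spec R) : Prop :=
  exists (Q : algType k) (j : {lrmorphism factor P -> Q}),
    goldie_quotient_ring j /\
    forall z : Q, center z -> algebraic_elt z.

Definition dixmier_moeglin (k : fieldType) (R : algType k) : Prop :=
  left_noetherian R /\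
  forall P : spec R,
    (locally_closed [set P] <-> primitive_ideal P) /\
    (primitive_ideal P <-> rational P).

(* Functors between categories of left modules that are k-linear on morphism
   spaces, where a in k acts on a module through the scalar a%:A. *)
Record module_functor (k : fieldType) (R S : algType k) := ModuleFunctor {
  fobj :> lmodType R -> lmodType S;
  fmor : forall M N : lmodType R, {linear M -> N} -> {linear fobj M -> fobj N};
  fmor_id : forall M : lmodType R, fmor (idfun : {linear M -> M}) =1 idfun;
  fmor_comp : forall (L M N : lmodType R)
      (g : {linear M -> N}) (f : {linear L -> M}),
    fmor (g \o f : {linear L -> N}) =1 fmor g \o fmor f;
  fmor_linear : forall (M N : lmodType R) (a : k) (f g h : {linear M -> N}),
    (forall m, h m = a%:A *: f m + g m) ->
    forall x, fmor h x = a%:A *: fmor f x + fmor g x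
}.

(* A natural isomorphism from the identity functor to G \o F. *)
Definition unit_iso (k : fieldType) (R S : algType k)
    (F : module_functor R S) (G : module_functor S R) : Prop :=
  exists eta : forall M : lmodType R, {linear M -> G (F M)},
    (forall M, bijective (eta M)) /\
    forall (M N : lmodType R) (f : {linear M -> N}),
      eta N \o f =1 fmor G (fmor F f) \o eta M.

(* Morita equivalence of k-algebras: the equivalence of module categories is
   required to be k-linear. An equivalence of plain categories only gives an
   isomorphism of rings between the centers, which may change the k-structure,
   and rationality is not invariant under such a change: take k = Q(t0, t1, ..),
   R = k, and S the ring k on which k acts through t_i |-> t_(i+1). *)
Definition morita_equivalent (k : fieldType) (R S : algType k) : Prop :=
  exists (F : module_functor R S) (G : module_functor S R),
    unit_iso F G /\ unit_iso G F.

Definition corner_pred (R : nzRingType) (e : R) : {pred R} :=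
  fun x => e * x * e == x.

(* The algebra eRe = {x | e x e = x}, with identity element e. *)
Record corner (k : fieldType) (R : algType k) (e : R)
    (e_idem : e * e = e) (e_neq0 : e != 0) := Corner {
  corner_val : R;
  corner_valP : corner_val \in corner_pred e
}.

Section Corner.
Variables (k : fieldType) (R : algType k) (e : R).
Hypotheses (e_idem : e * e = e) (e_neq0 : e != 0).
Local Notation eRe := (corner e_idem e_neq0).

Lemma corner_submod_closed : submod_closed (corner_pred e).
Proof.
split; first by rewrite unfold_in mulr0 mul0r.
move=> a x y; rewrite !unfold_in => /eqP ex /eqP ey.
by rewrite mulrDr mulrDl -scalerAr -scalerAl ex ey.
Qed.

HB.instance Definition _ := GRing.isSubmodClosed.Build k R (corner_pred e)
  corner_submod_closed.
HB.instance Definition _ := [isSub of eRe for @corner_val _ _ _ _ _].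
HB.instance Definition _ := [Choice of eRe by <:].
HB.instance Definition _ := [SubChoice_isSubLmodule of eRe by <:].

Lemma corner_mulel (x : eRe) : e * corner_val x = corner_val x.
Proof. by rewrite -[in LHS](eqP (corner_valP x)) !mulrA e_idem (eqP (corner_valP x)). Qed.

Lemma corner_muler (x : eRe) : corner_val x * e = corner_val x.
Proof. by rewrite -[in LHS](eqP (corner_valP x)) -!mulrA e_idem mulrA (eqP (corner_valP x)). Qed.

Lemma corner_one_subproof : e * e * e == e. Proof. by rewrite !e_idem. Qed.
Definition corner_one : eRe := Corner e_idem e_neq0 corner_one_subproof.

Lemma corner_mul_subproof (x y : eRe) :
  e * (corner_val x * corner_val y) * e == corner_val x * corner_val y.
Proof. by rewrite mulrA corner_mulel -mulrA corner_muler. Qed.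
Definition corner_mul (x y : eRe) : eRe :=
  Corner e_idem e_neq0 (corner_mul_subproof x y).

Lemma corner_mulA : associative corner_mul.
Proof. by move=> x y z; apply: val_inj; rewrite /= mulrA. Qed.

Lemma corner_mul1 : left_id corner_one corner_mul.
Proof. by move=> x; apply: val_inj; exact: corner_mulel. Qed.

Lemma corner_mulr1 : right_id corner_one corner_mul.
Proof. by move=> x; apply: val_inj; exact: corner_muler. Qed.

Lemma corner_mulDl : left_distributive corner_mul +%R.
Proof. by move=> x y z; apply: val_inj; rewrite /= mulrDl. Qed.

Lemma corner_mulDr : right_distributive corner_mul +%R.
Proof. by move=> x y z; apply: val_inj; rewrite /= mulrDr. Qed.

Lemma corner_one_neq0 : corner_one != 0.
Proof. by rewrite -val_eqE. Qed.

HB.instance Definition _ := GRing.Zmodule_isNzRing.Build eRe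
  corner_mulA corner_mul1 corner_mulr1 corner_mulDl corner_mulDr corner_one_neq0.

Lemma corner_scaleAl (a : k) (x y : eRe) : a *: (x * y) = (a *: x) * y.
Proof. by apply: val_inj; rewrite /= scalerAl. Qed.

HB.instance Definition _ := GRing.Lmodule_isLalgebra.Build k eRe corner_scaleAl.

Lemma corner_scaleAr (a : k) (x y : eRe) : a *: (x * y) = x * (a *: y).
Proof. by apply: val_inj; rewrite /= scalerAr. Qed.

HB.instance Definition _ := GRing.Lalgebra_isAlgebra.Build k eRe corner_scaleAr.

End Corner.

(* T, with the maps r |-> r (x) 1 and s |-> 1 (x) s, is the tensor product
   algebra of R and S over k: it carries the universal k-bilinear map
   (r, s) |-> i r * j s, and its product is
   (r (x) s) (r' (x) s') = r r' (x) s s'. This determines (T, i, j) up to a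
   unique isomorphism. *)
Definition tensor_product (k : fieldType) (R S T : algType k)
    (i : {lrmorphism R -> T}) (j : {lrmorphism S -> T}) : Prop :=
  (forall r s, i r * j s = j s * i r) /\
  forall (V : lmodType k) (b : {bilinear R -> S -> V}),
    exists f : {linear T -> V},
      (forall r s, f (i r * j s) = b r s) /\
      forall g : {linear T -> V}, (forall r s, g (i r * j s) = b r s) -> g =1 f.

(* p(f) = 0 in End_T(M). *)
Definition endo_root (k : fieldType) (T : algType k) (M : lmodType T)
    (f : {linear M -> M}) (p : {poly k}) : Prop :=
  forall m : M, \sum_(i < size p) (p`_i)%:A *: iter i f m = 0.

Definition nullstellensatz (k : fieldType) (T : algType k) : Prop :=
  (forall P : set T, prime_ideal P ->
     exists2 F : set (set T),
       (forall I, F I -> primitive_ideal I) & P = \bigcap_(I in F) I) /\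
  (forall M : lmodType T, simple_module M ->
     forall f : {linear M -> M}, exists2 p : {poly k}, p != 0 & endo_root f p).

(* Main.v *)
(* The idea is to express rationality inside R. For a prime P, an element of the
   extended centroid of R / P is a ratio a / s with a x s = s x a modulo P for
   all x, and by Goldie's theorem the centre of Q(R / P) is the extended
   centroid; its algebraicity only involves finite geometric progressions of
   elements of R with ratio a / s.

   In this form the three properties pass through a Morita context (R, S, M, N):
   P |-> {s | M s N <= P} is a bijection between the primes of R that do not
   contain the trace ideal M N and the primes of S that do not contain N M.
   A corner eRe and a Morita equivalent algebra both occur as the S of such a
   context with N M = S, which gives (a) and (b).

   For (c), let P be a rational prime of T. The extended centroid of R / (P n R)
   embeds in that of T / P, so P n R and P n S are rational, hence locally
   closed. It remains to see that no prime P1 > P has the same traces on R and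
   S: an element t of P1 outside P with the fewest terms a (x) b is t = z c
   modulo P, with c one of these terms and z in the extended centroid, and a
   polynomial relation for z then puts c in P1. The Nullstellensatz gives
   locally closed => primitive => rational. *)

Require Import Defs.
From HB Require Import structures.
From mathcomp Require Import all_boot all_order all_algebra.
From mathcomp Require Import generic_quotient ring_quotient sesquilinear.
From mathcomp Require Import boolp classical_sets topology.

Set Implicit Arguments.
Unset Strict Implicit.
Unset Printing Implicit Defensive.

Import GRing.Theory.

Local Open Scope classical_set_scope.
Local Open Scope ring_scope.

(** * Prime, primitive and locally closed ideals *)

Section Ideals.
Variable R : nzRingType.
Implicit Types (P I : set R).

Lemma idealB I x y : ideal I -> I x -> I y -> I (x - y).
Proof.
by move=> [_ ID IM _] Ix Iy; apply: ID => //; rewrite -mulN1r; apply: IM.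
Qed.

Lemma ideal_subK I x y : ideal I -> I (x - y) -> I y -> I x.
Proof. by move=> [_ ID _ _] Ixy Iy; rewrite -(subrK y x); apply: ID. Qed.

Lemma ideal_sum I (J : Type) (r : seq J) (p : pred J) (F : J -> R) :
  ideal I -> (forall j, p j -> I (F j)) -> I (\sum_(j <- r | p j) F j).
Proof.
by move=> [I0 ID _ _] IF; elim/big_ind: _ => // x y; apply: ID.
Qed.

Lemma prime_idealP P :
  prime_ideal P <->
  [/\ ideal P, ~ P 1 &
      forall a b, (forall x, P (a * x * b)) -> P a \/ P b].
Proof.
split=> [[iP nP pP]|[iP nP pP]]; split=> //.
- move=> P1; apply: nP; apply/seteqP; split=> // x _.
  by have [_ _ PM _] := iP; rewrite -[x]mulr1; apply: PM.
- move=> a b ab; have [P0 PD PM PMr] := iP.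
  (* [I] and [J] are two-sided ideals containing [a] and [b], with [I J] inside [P]; they stand in
     for the ideals generated by [a] and [b]. *)
  pose I := [set y | forall x, P (y * x * b)].
  pose J := [set z | forall y, I y -> forall x, P (y * x * z)].
  have iI : ideal I.
    split=> [x|x y Ix Iy z|r x Ix z|r x Ix z].
    - by rewrite !mul0r.
    - by rewrite !mulrDl; apply: PD; [apply: Ix|apply: Iy].
    - by rewrite -!mulrA; apply: PM; rewrite mulrA; apply: Ix.
    - by rewrite -(mulrA x); apply: Ix.
  have iJ : ideal J.
    split=> [y Iy x|x y Jx Jy z Iz w|r x Jx z Iz w|r x Jx z Iz w].
    - by rewrite mulr0.
    - by rewrite mulrDr; apply: PD; [apply: Jx|apply: Jy].
    - by rewrite mulrA -(mulrA z); apply: Jx.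
    - by rewrite mulrA; apply: PMr; apply: Jx.
  have IJP x y : I x -> J y -> P (x * y).
    by move=> Ix Jy; rewrite -[x]mulr1; apply: Jy.
  have [] := pP I J iI iJ IJP; first by move/(_ a); left; auto.
  by move/(_ b) => h; right; apply: h => y Iy; apply: Iy.
- by move=> PT; apply: nP; rewrite PT.
- move=> I J [_ _ _ IMr] [_ _ JM _] IJ; apply: contrapT => /not_orP[nI nJ].
  apply: nI => a Ia; apply: contrapT => nPa; apply: nJ => b Jb.
  by have [] // := pP a b; move=> x; apply: IJ => //; apply: IMr.
Qed.

Lemma prime_mulP P a b : prime_ideal P -> ~ P a -> ~ P b ->
  exists x, ~ P (a * x * b).
Proof.
move=> /prime_idealP[_ _ pP] nPa nPb; apply: contrapT => /forallNP h.
by have [] := pP a b => // x; apply: contrapT; apply: h.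
Qed.

End Ideals.

(** * Quotient modules *)

Section QuotientModule.
Variables (R : nzRingType) (M : lmodType R) (N : set M).
Hypothesis submodN : submodule N.

(** The proof that [N] is a submodule is carried as an argument so that the closure instance below
    can be inferred from the predicate alone. *)
Definition qmod_pred & submodule N : {pred M} := fun x => `[< N x >].

Lemma qmod_zmod_closed : zmod_closed (qmod_pred submodN).
Proof.
have [N0 ND] := submodN; split; first exact/asboolP.
move=> x y /asboolP Nx /asboolP Ny; apply/asboolP.
by rewrite addrC -scaleN1r; apply: ND.
Qed.

HB.instance Definition _ := GRing.isZmodClosed.Build M (qmod_pred submodN)
  qmod_zmod_closed.

Definition quotient_module : Type := {ideal_quot (qmod_pred submodN)}.

HB.instance Definition _ := GRing.Zmodule.on quotient_module.

Definition qmod_pi (x : M) : quotient_module :=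
  (\pi_{ideal_quot (qmod_pred submodN)} x)%qT.

Lemma qmod_piP x y : qmod_pi x = qmod_pi y <-> N (x - y).
Proof.
split=> [/eqP|Pxy]; first by rewrite -Quotient.idealrBE => /asboolP.
by apply/eqP; rewrite -Quotient.idealrBE; apply/asboolP.
Qed.

Lemma qmod_pi_surj q : exists x, qmod_pi x = q.
Proof. by exists (repr q)%qT; exact: reprK. Qed.

Lemma qmod_piB x y : qmod_pi (x - y) = qmod_pi x - qmod_pi y.
Proof. by rewrite /qmod_pi !piE. Qed.

Lemma qmod_piD x y : qmod_pi (x + y) = qmod_pi x + qmod_pi y.
Proof. by rewrite /qmod_pi !piE. Qed.

Definition qmod_scale (a : R) (q : quotient_module) : quotient_module :=
  qmod_pi (a *: repr q)%qT.

Lemma qmod_piZ a x : qmod_pi (a *: x) = qmod_scale a (qmod_pi x).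
Proof.
apply/esym/qmod_piP; have [N0 ND] := submodN.
rewrite -scalerBr -[_ *: _]addr0; apply: ND => //; apply/qmod_piP.
exact: reprK.
Qed.

Lemma qmod_scaleA a b q : qmod_scale a (qmod_scale b q) = qmod_scale (a * b) q.
Proof. by have [x <-] := qmod_pi_surj q; rewrite -!qmod_piZ scalerA. Qed.

Lemma qmod_scale1 : left_id 1 qmod_scale.
Proof. by move=> q; have [x <-] := qmod_pi_surj q; rewrite -qmod_piZ scale1r. Qed.

Lemma qmod_scaleDr : right_distributive qmod_scale +%R.
Proof.
move=> a p q; have [x <-] := qmod_pi_surj p; have [y <-] := qmod_pi_surj q.
by rewrite -qmod_piD -!qmod_piZ scalerDr qmod_piD.
Qed.

Lemma qmod_scaleDl q : {morph qmod_scale^~ q : a b / a + b}.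
Proof.
move=> a b; have [x <-] := qmod_pi_surj q.
by rewrite -!qmod_piZ scalerDl qmod_piD.
Qed.

HB.instance Definition _ := GRing.Zmodule_isLmodule.Build R quotient_module
  qmod_scaleA qmod_scale1 qmod_scaleDr qmod_scaleDl.
HB.instance Definition _ := GRing.isZmodMorphism.Build M quotient_module
  qmod_pi qmod_piB.
HB.instance Definition _ := GRing.isScalable.Build R M quotient_module *:%R
  qmod_pi qmod_piZ.

Lemma qmod_pi_eq0 x : qmod_pi x = 0 <-> N x.
Proof. by rewrite -(raddf0 qmod_pi) qmod_piP subr0. Qed.

End QuotientModule.

(** * Primitive ideals through maximal left ideals *)

Section Primitive.
Variable R : nzRingType.
Implicit Types (P I : set R).

(** Maximality is stated as [I + R s = R] for [s] outside [I], the form that can be computed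
    with. *)
Definition maximal_left_ideal I : Prop :=
  [/\ left_ideal I, ~ I 1 & forall s, ~ I s -> exists r, I (1 - r * s)].

Lemma left_idealM I r x : left_ideal I -> I x -> I (r * x).
Proof. by move=> [I0 ID] Ix; rewrite -[r * x]addr0; apply: (ID r). Qed.

Lemma left_idealD I x y : left_ideal I -> I x -> I y -> I (x + y).
Proof. by move=> [I0 ID] Ix Iy; rewrite -[x]mul1r; apply: (ID 1). Qed.

Lemma simple_module_generator (M : lmodType R) (m : M) :
  simple_module M -> m <> 0 -> forall x, exists r, x = r *: m.
Proof.
move=> [_ sM] m0 x; pose N := [set x | exists r, x = r *: m].
have [|N0|NT] := sM N.
- split; first by exists 0; rewrite scale0r.
  by move=> a _ _ [r ->] [s ->]; exists (a * r + s); rewrite scalerDl scalerA.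
- by have : N m; [exists 1; rewrite scale1r|rewrite N0 => /m0].
- by have : N x by rewrite NT.
Qed.

(** A simple module is [R / I] for [I] the annihilator of a nonzero vector, and [r] kills [R / I]
    exactly when [r R] lies in [I]. This removes modules from the transfer arguments below. *)
Lemma primitive_idealP P : primitive_ideal P <->
  exists2 I, maximal_left_ideal I & P = [set r | forall x, I (r * x)].
Proof.
split=> [[M sM ->]|[I mI ->]].
  have [[m /eqP m0] _] := sM; have gM := simple_module_generator sM.
  exists [set r | r *: m = 0].
    split=> [|/=|s /= sm].
    - split=> [|a u v /= um vm] /=; first by rewrite scale0r.
      by rewrite scalerDl -scalerA um vm scaler0 addr0.
    - by rewrite scale1r.
    - have [r rE] := gM _ sm m; exists r.
      by rewrite scalerBl scale1r -scalerA -rE subrr.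
  apply/seteqP; split=> r /= rM x; first by rewrite -scalerA rM.
  by have [y ->] := gM _ m0 x; rewrite scalerA rM.
have [lI nI1 mxI] := mI; have [I0 ID] := lI.
pose M : lmodType R := quotient_module lI.
pose p : {linear R^o -> M} := @qmod_pi R R^o I lI.
have pE x : p x = x *: p 1.
  by rewrite -linearZ -[x *: _]/(x * 1) mulr1.
exists M; first split.
- by exists (p 1); apply/eqP => /qmod_pi_eq0.
- move=> N [N0 ND]; have [h|h] := pselect (exists2 s, ~ I s & N (p s)).
    right; have [s Is Ns] := h; have [r rs] := mxI s Is.
    have Np1 : N (p 1).
      have -> : p 1 = r *: p s + 0.
        rewrite addr0 -linearZ; apply/qmod_piP; exact: rs.
      exact: ND.
    apply/seteqP; split=> // q _; have [x <-] := qmod_pi_surj q.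
    by rewrite -/(p x) pE -[_ *: _]addr0; apply: ND.
  left; apply/seteqP; split=> [q Nq|q ->] //.
  have [x xq] := qmod_pi_surj q; rewrite -xq; apply/qmod_pi_eq0.
  apply: contrapT => nIx; apply: h; exists x => //.
  by have -> : p x = q by [].
- apply/seteqP; split=> [r rI q|r rM x].
    have [x <-] := qmod_pi_surj q; rewrite -linearZ; apply/qmod_pi_eq0.
    exact: rI.
  apply/(@qmod_pi_eq0 R R^o I lI).
  by rewrite -[qmod_pi _ _]/(p (r *: (x : R^o))) linearZ; apply: rM.
Qed.

(** If [b x] is nonzero it generates the simple module, so [a R b] killing the module forces [a] to
    kill it. *)
Lemma primitive_ideal_prime P : primitive_ideal P -> prime_ideal P.
Proof.
move=> [M sM ->]; have [[m /eqP m0] _] := sM.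
have gM := simple_module_generator sM; apply/prime_idealP; split.
- split=> [x|x y ax ay z|r x ax z|r x ax z] /=; first by rewrite scale0r.
  + by rewrite scalerDl ax ay addr0.
  + by rewrite -scalerA ax scaler0.
  + by rewrite -scalerA ax.
- by move=> /(_ m); rewrite scale1r.
- move=> a b ab; have [|/existsNP[x bx]] := pselect (annihilator M b); first by right.
  left=> y; have [r ->] := gM _ bx y.
  by rewrite !scalerA ab.
Qed.

End Primitive.

(** * Locally closed points of the spectrum *)

Section LocallyClosed.
Variable R : nzRingType.

Definition locally_closed_ideal (P : set R) : Prop :=
  exists2 r, ~ P r &
    forall Q, prime_ideal Q -> P `<=` Q -> ~ (Q `<=` P) -> Q r.

(** If [{P}] is the intersection of a closed set with the complement of the closed set of [I], any
    [r] in [I] outside [P] is a witness. Conversely, let [I] be the intersection of the primes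
    strictly above [P]; then [P] is the only prime that contains [P] but not [I]. *)
Lemma locally_closedP (P : spec R) :
  locally_closed [set P] <-> locally_closed_ideal P.
Proof.
have eqP (Q : spec R) : spec_ideal P `<=` Q -> spec_ideal Q `<=` P -> Q = P.
  move=> PQ QP; have : spec_ideal Q = spec_ideal P by apply/seteqP.
  case: Q P {PQ QP} => [Q hQ] [P' hP'] /= QP; subst.
  by congr Spec; exact: Prop_irrelevance.
split=> [[U [C [oU cC PUC]]]|[r nPr hr]].
  have [I iI UE] : zariski_open U by [].
  have /zariski_closedP[J iJ CE] := cC.
  have : (U `&` C) P by rewrite -PUC.
  rewrite UE CE => -[/= /existsNP[r /not_implyP[Ir nPr]] JP].
  exists r => // Q pQ PQ nQP; apply: contrapT => nQr; apply: nQP.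
  suff <- : Spec pQ = P by [].
  have : [set P] (Spec pQ); last by [].
  rewrite PUC UE CE; split=> /=; first by move/(_ r Ir).
  exact: subset_trans PQ.
pose D := [set Q : set R | [/\ prime_ideal Q, spec_ideal P `<=` Q &
   ~ (Q `<=` P)]].
pose I := \bigcap_(Q in D) Q.
have iI : ideal I.
  by apply: ideal_bigcap => Q [[]].
exists [set Q : spec R | ~ I `<=` Q], [set Q : spec R | spec_ideal P `<=` Q].
split.
- have : zariski_open [set Q : spec R | ~ I `<=` Q] by exists I.
  by [].
- by apply/zariski_closedP; exists P => //; have [] := spec_prime P.
- apply/seteqP; split=> [Q ->|Q [/= nIQ PQ]].
    split=> //= IP; apply: nPr; apply: IP => Q' [pQ' PQ' nQ'].
    exact: hr.
  apply: contrapT => QP; apply: nIQ => x; apply; split=> //.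
    exact: spec_prime.
  by move=> QP'; apply: QP; apply: eqP.
Qed.

End LocallyClosed.

(** * The extended centroid modulo a prime ideal *)

Section CongruenceModIdeal.
Variables (R : nzRingType) (I : set R).
Hypothesis idealI : ideal I.

Lemma cong_refl x : I (x - x).
Proof. by rewrite subrr; have [] := idealI. Qed.

Lemma cong_sym x y : I (x - y) -> I (y - x).
Proof.
by move=> Ixy; rewrite -opprB -sub0r; apply: idealB => //; have [] := idealI.
Qed.

Lemma cong_trans y x z : I (x - y) -> I (y - z) -> I (x - z).
Proof.
by have [_ ID _ _] := idealI => xy yz; rewrite -(subrK y x) -addrA; apply: ID.
Qed.

Lemma congMl z x y : I (x - y) -> I (z * x - z * y).
Proof. by have [_ _ IM _] := idealI => xy; rewrite -mulrBr; apply: IM. Qed.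

Lemma congMr z x y : I (x - y) -> I (x * z - y * z).
Proof. by have [_ _ _ IM] := idealI => xy; rewrite -mulrBl; apply: IM. Qed.

Lemma congP x y : I (x - y) -> I x <-> I y.
Proof.
by move=> xy; split; apply: ideal_subK => //; apply: cong_sym.
Qed.

Lemma cong_sum (J : Type) (r : seq J) (p : pred J) (F G : J -> R) :
  (forall j, p j -> I (F j - G j)) ->
  I (\sum_(j <- r | p j) F j - \sum_(j <- r | p j) G j).
Proof. by move=> FG; rewrite -sumrB; apply: ideal_sum. Qed.

End CongruenceModIdeal.

Section ExtendedCentroid.
Variables (k : fieldType) (R : algType k).
Implicit Types (P : set R) (s a : R) (u v : nat -> R) (c : nat -> k).

Lemma idealZ P (b : k) x : ideal P -> P x -> P (b *: x).
Proof. by move=> [_ _ PM _] Px; rewrite -mulr_algl; apply: PM. Qed.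

(* For a prime P and s outside P, this says that a / s is an element of the
   extended centroid of R / P. *)
Definition proportional P s a := forall x, P (a * x * s - s * x * a).

(* Modulo P, u is geometric with ratio a / s, up to index n - 1. *)
Definition progression P s a n u :=
  forall l, (l.+1 < n)%N -> forall x, P (u l.+1 * x * s - u l * x * a).

(* The ratio a / s is a root of the nonzero polynomial of coefficients c. *)
Definition algebraic_ratio P s a := exists n c u,
  [/\ exists2 l, (l < n)%N & c l != 0,
      progression P s a n u, ~ P (u 0%N) & P (\sum_(l < n) c l *: u l)].

(** For a prime [P], algebraicity over [k] of the extended centroid of [R / P], expressed by
    elements of [R] only. *)
Definition algebraic_centroid P :=
  forall s a, ~ P s -> proportional P s a -> algebraic_ratio P s a.

Section Prime.
Variables (P : set R) (s a : R).
Hypotheses (primeP : prime_ideal P) (nPs : ~ P s).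
Let iP : ideal P. Proof. by have [] := primeP. Qed.

Lemma prime_cancel x : (forall y, P (x * y * s)) -> P x.
Proof.
by move=> xs; apply: contrapT => /prime_mulP-/(_ s primeP nPs)[y].
Qed.

Lemma prime_cong_cancel x y :
  (forall z, P (x * z * s - y * z * s)) -> P (x - y).
Proof. by move=> xy; apply: prime_cancel => z; rewrite !mulrBl. Qed.

(** Both sides equal [u 0 * y * v 0] times the [l]-th power of [a / s]. In the induction,
    multiplying by [z * s] trades [s] for [a] in [v], and then [a] for [s] in [u]. *)
Lemma progression_cross n u v l : progression P s a n u ->
  progression P s a n v -> (l < n)%N ->
  forall y, P (u 0%N * y * v l - u l * y * v 0%N).
Proof.
move=> pu pv; elim: l => [|l IHl] ln y; first exact: cong_refl.
have {}IHl := IHl (ltnW ln); apply: prime_cong_cancel => z.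
apply: (cong_trans iP (y := u 0%N * y * v l * z * a)).
  by rewrite -!mulrA; do 2!apply: (congMl iP); rewrite !mulrA; apply: pv.
apply: (cong_trans iP (y := u l * y * v 0%N * z * a)).
  by do 2!apply: (congMr iP).
apply: cong_sym => //.
have E w t : w * y * v 0%N * z * t = w * (y * v 0%N * z) * t by rewrite !mulrA.
by rewrite !E; apply: pu.
Qed.

(** Two ideals are kept apart: the relations hold modulo [P1], while the first term avoids the prime
    [P]. The tensor product argument needs a first term outside a prime larger than the modulus. *)
Lemma progression_exists P1 n : ideal P1 -> proportional P1 s a ->
  exists2 u, progression P1 s a n.+1 u & ~ P (u 0%N).
Proof.
move=> iP1 sa; elim: n => [|n [u pu nPu]].
  by exists (fun=> 1); [case|case/prime_idealP: primeP].
have [x nPx] := prime_mulP primeP nPu nPs.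
(* The old terms are multiplied by [x * s], which leaves room for one more term, [u n * x * a]; [x]
   is chosen so that the first term stays outside [P]. *)
exists (fun l => if (l <= n)%N then u l * x * s else u n * x * a) => //= l.
rewrite ltnS leq_eqVlt ltnS => /predU1P[[->]|ln] y.
  by rewrite ltnn leqnn -!mulrA; do 2!apply: (congMl iP1); rewrite !mulrA.
rewrite ln ltnW //.
have -> : u l.+1 * x * s * y * s = u l.+1 * (x * s * y) * s by rewrite !mulrA.
have -> : u l * x * s * y * a = u l * (x * s * y) * a by rewrite !mulrA.
exact: pu.
Qed.

(** Being a root depends on the ratio only: by [progression_cross], [u 0 * y] times the sum for [v]
    is congruent to the sum for [u] times [y * v 0], and [u 0] can be cancelled. *)
Lemma progression_root n c u v : progression P s a n u -> ~ P (u 0%N) ->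
  P (\sum_(l < n) c l *: u l) -> progression P s a n v ->
  P (\sum_(l < n) c l *: v l).
Proof.
move=> pu nPu cu pv; have [_ _ pP] := (prime_idealP P).1 primeP.
have [] // := pP (u 0%N) (\sum_(l < n) c l *: v l) => y.
have [_ _ _ PMr] := iP.
apply/(congP iP (y := (\sum_(l < n) c l *: u l) * y * v 0%N)).
  rewrite mulr_sumr !mulr_suml; apply: cong_sum => // l _.
  rewrite -scalerAr -!scalerAl -scalerBr; apply: idealZ => //.
  exact: (progression_cross pu pv).
by apply: (PMr); apply: PMr.
Qed.

(** A nonzero ratio allows division of the polynomial by its variable: while the constant
    coefficient vanishes, [c] and [u] are shifted. [u 1] stays outside [P] because [u 1 * x * s] is
    congruent to [u 0 * x * a]. *)
Lemma algebraic_ratio_neq0 : ~ P a -> algebraic_ratio P s a ->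
  exists n c u, [/\ c 0%N != 0, progression P s a n.+1 u, ~ P (u 0%N)
    & P (\sum_(l < n.+1) c l *: u l)].
Proof.
move=> nPa [n [c [u [[l ln cl]]]]].
elim: n c u l ln cl => // n IHn c u l ln cl pu nPu cu.
have [c0|c0] := eqVneq (c 0%N) 0; last by exists n, c, u.
case: l ln cl => [|l]; rewrite ?c0 ?eqxx // !ltnS => ln cl.
apply: (IHn (fun l => c l.+1) (fun l => u l.+1) l) => //.
- by move=> m mn; apply: pu.
- move=> Pu1; have [x] := prime_mulP primeP nPu nPa; apply.
  have [_ _ _ PMr] := iP.
  apply/(congP iP (y := u 1%N * x * s)); last by apply: (PMr); apply: PMr.
  by apply: cong_sym => //; apply: pu; rewrite ltnS; case: (n) ln.
- by move: cu; rewrite big_ord_recl c0 scale0r add0r.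
Qed.

End Prime.
End ExtendedCentroid.

(** * Goldie's theorem *)

Section Goldie.
Variable A : nzRingType.
Hypothesis primeA : forall a b : A, (forall x, a * x * b = 0) -> a = 0 \/ b = 0.
Hypothesis noethA : left_noetherian A.
Implicit Types (E I : set A) (a b c r s t x y : A).

Lemma noetherian_max (D : set (set A)) I :
  (forall J, D J -> left_ideal J) -> D I ->
  exists2 J, D J & forall K, D K -> J `<=` K -> K `<=` J.
Proof.
move=> Dl DI; apply: contrapT => nmax.
have step (J : {J | D J}) : exists K : {J | D J},
    sval J `<=` sval K /\ ~ (sval K `<=` sval J).
  case: J => J DJ /=; apply: contrapT => h; apply: nmax; exists J => // K DK JK.
  by apply: contrapT => KJ; apply: h; exists (exist _ K DK).
have [f fP] := choice step.
pose g n := sval (iter n f (exist _ I DI)).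
have [n|n|N gN] := noethA (I := g).
- by apply: Dl; rewrite /g; case: (iter _ _ _).
- by have [] := fP (iter n f (exist _ I DI)).
- by have [_] := fP (iter N f (exist _ I DI)); apply; rewrite -/(g N) -(gN N.+1).
Qed.

Definition lann x : set A := [set r | r * x = 0].

Lemma lann_left_ideal x : left_ideal (lann x).
Proof.
split=> [|r u v /= ux vx]; rewrite /lann /= ?mul0r // mulrDl vx addr0.
by rewrite -[_ *: _]/(r * u) -mulrA ux mulr0.
Qed.

Definition essential E : Prop :=
  left_ideal E /\ forall x, x <> 0 -> exists2 r, r * x <> 0 & E (r * x).

Lemma essential_colon E a : essential E -> essential [set r | E (r * a)].
Proof.
move=> [lE eE]; split.
  split=> [|r u v /= Eu Ev] /=; first by rewrite mul0r; have [] := lE.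
  rewrite mulrDl; apply: left_idealD => //.
  by rewrite -[_ *: _]/(r * u) -mulrA; apply: left_idealM.
move=> x x0; have [xa|xa] := pselect (x * a = 0).
  by exists 1; rewrite mul1r //= xa; have [] := lE.
have [r rxa Er] := eE _ xa; exists r; last by rewrite /= -mulrA.
by move=> rx; apply: rxa; rewrite mulrA rx mul0r.
Qed.

(** Among the nonzero elements with essential annihilator, take [y] with [lann y] maximal. If
    [y r y] were nonzero, [lann (y r y)] would equal [lann y]; but [lann (r y)] is essential, so
    some [t] has [t y <> 0] and [t y r y = 0]. Hence [y A y = 0], against primeness. *)
Lemma nonsingular x : essential (lann x) -> x = 0.
Proof.
move=> ex; apply: contrapT => x0.
pose D := [set I | exists y, [/\ y <> 0, essential (lann y) & I = lann y]].
have [_ [y [y0 ey ->]] ymax] : exists2 J, D J &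
    forall K, D K -> J `<=` K -> K `<=` J.
  apply: (@noetherian_max D (lann x)); last by exists x.
  by move=> _ [z [_ _ ->]]; apply: lann_left_ideal.
have eM r : essential (lann (r * y)).
  have := essential_colon r ey.
  by congr essential; apply/seteqP; split=> t; rewrite /lann /= mulrA.
have [] : y = 0 \/ y = 0; [|by []..].
apply: primeA => r; apply: contrapT => yry.
have [_ /(_ y y0)[t ty0 tyry]] := eM r.
apply: ty0; apply: (ymax (lann (y * r * y))).
- by exists (y * r * y); split=> //; apply: eM.
- by move=> u /= uy; rewrite /lann /= !mulrA uy !mul0r.
- by rewrite /lann /= -mulrA mulrA.
Qed.

(* If A x met A c trivially, the sum of the A x c ^+ n would be direct. *)
Lemma essential_principal c : (forall r, r * c = 0 -> r = 0) ->
  essential [set r | exists y, r = y * c].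
Proof.
move=> c0; split.
  split=> [|r _ _ [u ->] [v ->]]; first by exists 0; rewrite mul0r.
  by exists (r * u + v); rewrite mulrDl -mulrA.
move=> x x0; apply: contrapT => nx.
have {}nx r y : r * x = y * c -> r * x = 0.
  by move=> rx; apply: contrapT => rx0; apply: nx; exists r => //; exists y.
pose I := fix I n : set A := if n is m.+1
  then [set z | exists r y, I m y /\ z = r * x + y * c] else [set 0].
have II n : I n `<=` I n.+1.
  elim: n => [_ ->|n IHn z [r [y [Iy ->]]]].
    by exists 0, 0; rewrite !mul0r addr0.
  by exists r, y; split=> //; apply: IHn.
have lI n : left_ideal (I n).
  elim: n => [|n IHn]; first by split=> // r u v -> ->; rewrite scaler0 addr0.
  split; first by exists 0, 0; rewrite !mul0r addr0; split=> //; have [] := IHn.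
  move=> r _ _ [u [v [Iv ->]]] [w [z [Iz ->]]].
  exists (r * u + w), (r * v + z); split; first by have [_] := IHn; apply.
  by rewrite scalerDr !mulrDl addrACA -!mulrA.
have nI n : ~ I n (x * c ^+ n).
  elim: n => [|n IHn]; first by rewrite mulr1.
  move=> [r [y [Iy]]]; rewrite exprSr mulrA => E.
  have rx : r * x = 0.
    by apply: (nx r (x * c ^+ n - y)); rewrite mulrBl E addrK.
  move: E; rewrite rx add0r => /eqP; rewrite -subr_eq0 -mulrBl => /eqP/c0/eqP.
  by rewrite subr_eq0 => /eqP E; apply: IHn; rewrite E.
have In n : I n.+1 (x * c ^+ n).
  elim: n => [|n IHn]; first by exists 1, 0; rewrite mul1r mul0r addr0 mulr1.
  by exists 0, (x * c ^+ n); rewrite mul0r add0r -mulrA -exprSr.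
have [N IN] := noethA lI II.
by apply: (nI N); rewrite -(IN N.+1).
Qed.

(** If [c y = 0], then [lann y] contains the essential left ideal [A c], so [y = 0] by
    [nonsingular]. *)
Lemma regularP c : (forall r, r * c = 0 -> r = 0) -> regular c.
Proof.
move=> c0; split; last exact: mulIr0_rreg.
apply: mulrI0_lreg => y cy; apply: nonsingular.
have [_ ec] := essential_principal c0; split; first exact: lann_left_ideal.
move=> x /ec[r rx0 [z rx]]; exists r => //.
by rewrite /lann /= rx -mulrA cy mulr0.
Qed.

(** Take [y] in [I] with maximal annihilator and [r] with [y r y <> 0]. Then
    [lann (y r y) = lann y], and [r y] has the required property. *)
Lemma left_ideal_nonnilpotent I x : left_ideal I -> I x -> x <> 0 ->
  exists y, [/\ I y, y <> 0 & forall r, r * y * y = 0 -> r * y = 0].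
Proof.
move=> lI Ix x0.
pose D := [set J | exists y, [/\ I y, y <> 0 & J = lann y]].
have [_ [y [Iy y0 ->]] ymax] : exists2 J, D J &
    forall K, D K -> J `<=` K -> K `<=` J.
  apply: (@noetherian_max D (lann x)); last by exists x.
  by move=> _ [z [_ _ ->]]; apply: lann_left_ideal.
have [r yry] : exists r, y * r * y <> 0.
  apply: contrapT => /forallNP h; have [] : y = 0 \/ y = 0; [|by []..].
  by apply: primeA => r; apply: contrapT; apply: h.
exists (r * y); split.
- exact: left_idealM.
- by move=> ry; apply: yry; rewrite -mulrA ry mulr0.
- move=> t try; rewrite mulrA; apply: (ymax (lann (y * r * y))).
  + by exists (y * r * y); split=> //; apply: left_idealM.
  + by move=> u /= uy; rewrite /lann /= !mulrA uy !mul0r.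
  + by rewrite /lann /= -[RHS]try !mulrA.
Qed.

(** Choose [c] in [E] with [lann (c ^ 2) = lann c], together with a left ideal [K] that meets
    [lann c] trivially, so that [K] is maximal. If [lann c] is nonzero, it meets [E] in some nonzero
    [y] with [lann (y ^ 2) = lann y]; since [y c = 0], the pair [c + y], [K + A y] contradicts
    maximality. *)
Lemma essential_regular E : essential E -> exists2 c, E c & regular c.
Proof.
move=> [lE eE].
pose good c K := [/\ E c, forall r, r * c * c = 0 -> r * c = 0 &
  forall r, K r -> r * c = 0 -> r = 0].
pose D := [set K | left_ideal K /\ exists c, good c K].
have [K [lK [c [Ec cc Kc]]] maxK] : exists2 J, D J &
    forall K, D K -> J `<=` K -> K `<=` J.
  apply: (@noetherian_max D [set 0]); first by move=> J [].
  split; first by split=> // r u v -> ->; rewrite scaler0 addr0.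
  by exists 0; split=> // [|r]; rewrite ?mulr0 //; have [] := lE.
exists c => //; apply: regularP => r0 rc0; apply: contrapT => nr0.
have [r1 r10 Er1] := eE _ nr0.
pose L := [set y | E y /\ y * c = 0].
have lL : left_ideal L.
  have [E0 ED] := lE; have [L0 LD] := lann_left_ideal c; split; first by split.
  by move=> a u v [Eu uc] [Ev vc]; split; [apply: ED|apply: LD].
have Lr : L (r1 * r0) by split=> //; rewrite -mulrA rc0 mulr0.
have [y [[/= Ey yc] y0 yy]] := left_ideal_nonnilpotent lL Lr r10.
have cyP r : r * (c + y) = 0 -> r * c = 0 /\ r * y = 0.
  move=> rcy; have rc : r * c = 0.
    apply: cc; have : r * (c + y) * c = 0 by rewrite rcy mul0r.
    by rewrite mulrDr mulrDl -(mulrA r y) yc mulr0 addr0.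
  by move: rcy; rewrite mulrDr rc add0r.
pose K' := [set z | exists u v, K u /\ z = u + v * y].
have K'y : K' y.
  by exists 0, 1; rewrite mul1r add0r; split=> //; have [] := lK.
suff DK' : D K'.
  have Ky : K y.
    apply: (maxK K') => // u Ku; exists u, 0.
    by rewrite mul0r addr0.
  exact: y0 (Kc _ Ky yc).
split.
  split; first by exists 0, 0; rewrite mul0r addr0; split=> //; have [] := lK.
  move=> r _ _ [u [v [Ku ->]]] [w [z [Kw ->]]].
  exists (r * u + w), (r * v + z); split; first by have [_] := lK; apply.
  by rewrite scalerDr mulrDl addrACA -!mulrA.
exists (c + y); split; first exact: left_idealD.
- move=> r /cyP[]; rewrite !mulrDr !mulrDl -!(mulrA _ y) yc mulr0 addr0.
  move=> /cc rc; rewrite rc mul0r add0r => h.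
  by rewrite add0r; apply: yy; rewrite -mulrA.
- move=> _ [u [v [Ku ->]]] /cyP[]; rewrite !mulrDl -!mulrA yc mulr0 addr0.
  move=> uc; rewrite (Kc u) // mul0r !add0r => h.
  by apply: yy; rewrite -mulrA.
Qed.

(** [A s] is essential, hence so is the left ideal of the [t] with [t a] in [A s], and it contains a
    regular element. *)
Lemma left_ore s a : regular s -> exists t b, regular t /\ t * a = b * s.
Proof.
move=> [_ rs]; have s0 r : r * s = 0 -> r = 0.
  by move=> rs0; apply: rs; rewrite rs0 mul0r.
have [t [b tb] rt] :=
  essential_regular (essential_colon a (essential_principal s0)).
by exists t, b.
Qed.

Lemma ideal_regular I : ideal I -> (exists2 x, I x & x <> 0) ->
  exists2 c, I c & regular c.
Proof.
move=> [I0 ID IM IMr] [a Ia a0]; apply: essential_regular; split.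
  by split=> // r u v Iu Iv; apply: ID => //; apply: IM.
move=> x x0; apply: contrapT => h.
have [] : a = 0 \/ x = 0; [|by []..]; apply: primeA => y; apply: contrapT => ayx.
by apply: h; exists (a * y) => //; apply/IMr/IMr.
Qed.

Lemma regularM s t : regular s -> regular t -> regular (s * t).
Proof. by move=> [? ?] [? ?]; split; [apply: lregM|apply: rregM]. Qed.

Lemma regular1 : regular (1 : A).
Proof. by split; [apply: lreg1|apply: rreg1]. Qed.

End Goldie.

(* An element q of the ring of quotients is encoded as the graph of the partial
   map x |-> x q, defined on the left ideal {x | x q is in A}. *)
Record quotient_graph (A : nzRingType) (G : A -> A -> Prop) : Prop := {
  qgraph_lin : forall r x y x' y', G x y -> G x' y' -> G (r * x + x') (r * y + y');
  qgraph_fun : forall y, G 0 y -> y = 0;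
  qgraph_sat : forall t x y, regular t -> G (t * x) (t * y) -> G x y;
  qgraph_dom : exists s y, regular s /\ G s y
}.

(** The proofs of primeness and noetherianity are parameters of the type, so that the ring
    structure, which rests on them, can be inferred from it. *)
Record ore_quotient (A : nzRingType)
    (primeA : forall a b : A, (forall x, a * x * b = 0) -> a = 0 \/ b = 0)
    (noethA : left_noetherian A) := OreQuotient {
  ograph :> A -> A -> Prop;
  ographP : quotient_graph ograph
}.

HB.instance Definition _ A primeA noethA :=
  gen_eqMixin (@ore_quotient A primeA noethA).
HB.instance Definition _ A primeA noethA :=
  gen_choiceMixin (@ore_quotient A primeA noethA).

(** * The left ring of quotients *)

Section OreRing.
Variables (A : nzRingType).
Hypothesis primeA : forall a b : A, (forall x, a * x * b = 0) -> a = 0 \/ b = 0.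
Hypothesis noethA : left_noetherian A.
Local Notation Q := (ore_quotient primeA noethA).
Implicit Types (q p : Q) (r s t x y z : A).

Lemma og0 q : q 0 0.
Proof.
have [l _ _ [s [y [_ qs]]]] := ographP q.
by have := l (-1) _ _ _ _ qs qs; rewrite !mulN1r !addNr.
Qed.

Lemma ogZ q r x y : q x y -> q (r * x) (r * y).
Proof.
have [l _ _ _] := ographP q => qx.
by have := l r _ _ _ _ qx (og0 q); rewrite !addr0.
Qed.

Lemma ogD q x y x' y' : q x y -> q x' y' -> q (x + x') (y + y').
Proof.
have [l _ _ _] := ographP q => qx qx'.
by have := l 1 _ _ _ _ qx qx'; rewrite !mul1r.
Qed.

Lemma og_fun q x y z : q x y -> q x z -> y = z.
Proof.
have [l f _ _] := ographP q => qy qz; apply/eqP; rewrite -subr_eq0; apply/eqP/f.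
by have := l (-1) _ _ _ _ qz qy; rewrite !mulN1r addNr addrC.
Qed.

Lemma og_sat q t x y : regular t -> q (t * x) (t * y) -> q x y.
Proof. by have [_ _ + _] := ographP q; apply. Qed.

Lemma og_dense q x : exists t z, regular t /\ q (t * x) z.
Proof.
have [_ _ _ [s [y [rs qs]]]] := ographP q.
have [t [b [rt tb]]] := left_ore primeA noethA x rs.
by exists t, (b * y); split=> //; rewrite tb; apply: ogZ.
Qed.

(** The value at one regular [s] determines all others: by the Ore condition [t x = b s] with [t]
    regular, and saturation cancels [t]. Identities in [Q] are thus checked at a single common
    denominator. *)
Lemma ograph_ext q p s y : regular s -> q s y -> p s y -> q = p.
Proof.
move=> rs.
have sub (q' p' : Q) : q' s y -> p' s y -> forall x z, q' x z -> p' x z.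
  move=> qs ps x z qx.
  have [t [b [rt tb]]] := left_ore primeA noethA x rs.
  apply: (og_sat rt).
  have -> : t * z = b * y.
    by apply: (og_fun (ogZ t qx)); rewrite tb; apply: ogZ.
  by rewrite tb; apply: ogZ.
move=> qs ps; have : ograph q = ograph p.
  by apply/funext => x; apply/funext => z; apply/propext; split; apply: sub.
case: q p {qs ps} => [q hq] [p hp] /= qp; subst.
by congr OreQuotient; exact: Prop_irrelevance.
Qed.

(** The element is the saturation of [F] under cancelling regular left factors; the Ore condition
    keeps it linear. Operations on [Q] therefore need a definition only where they can be computed
    inside [A]. *)
Lemma ograph_extend (F : A -> A -> Prop) :
  (forall r x y x' y', F x y -> F x' y' -> F (r * x + x') (r * y + y')) ->
  (forall y, F 0 y -> y = 0) -> (exists s y, regular s /\ F s y) ->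
  exists q, forall x y, F x y -> q x y.
Proof.
move=> Fl Ff [s [y [rs Fs]]].
have F0 : F 0 0 by have := Fl (-1) _ _ _ _ Fs Fs; rewrite !mulN1r !addNr.
have FZ r x z : F x z -> F (r * x) (r * z).
  by move=> Fx; have := Fl r _ _ _ _ Fx F0; rewrite !addr0.
pose G x z := exists2 t, regular t & F (t * x) (t * z).
have FG x z : F x z -> G x z.
  by move=> Fx; exists 1; rewrite ?mul1r //; apply: regular1.
suff hG : quotient_graph G by exists (OreQuotient primeA noethA hG).
split.
- move=> r x z x' z' [t rt Ft] [t' rt' Ft'].
  have [u [w [ru uw]]] := left_ore primeA noethA r rt.
  have [v [w' [rv vw]]] := left_ore primeA noethA u rt'.
  exists (v * u); first exact: regularM.
  rewrite !mulrDr !(mulrA _ r) -!(mulrA v u r) uw vw -!mulrA.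
  by apply: (Fl v); do ?apply: FZ.
- move=> z [t [rt _]]; rewrite mulr0 => /Ff tz.
  by apply: rt; rewrite tz mulr0.
- by move=> t x z rt [u ru Fu]; exists (u * t); [apply: regularM|rewrite -!mulrA].
- by exists s, y; split=> //; apply: FG.
Qed.

Lemma oinj_subproof (a : A) : exists q, forall x, q x (x * a).
Proof.
have [|||q qF] := @ograph_extend (fun x y => y = x * a).
- by move=> r x _ x' _ -> ->; rewrite mulrDl mulrA.
- by move=> y ->; rewrite mul0r.
- by exists 1, (1 * a); split=> //; apply: regular1.
by exists q => x; apply: qF.
Qed.

Lemma oadd_subproof q p :
  exists q', forall x y z, q x y -> p x z -> q' x (y + z).
Proof.
have [|||q' qF] :=
  @ograph_extend (fun x y => exists u v, [/\ q x u, p x v & y = u + v]).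
- move=> r x _ x' _ [u [v [qx px ->]]] [u' [v' [qx' px' ->]]].
  exists (r * u + u'), (r * v + v'); split.
  + by apply: ogD => //; apply: ogZ.
  + by apply: ogD => //; apply: ogZ.
  + by rewrite mulrDr addrACA.
- move=> _ [u [v [qu pv ->]]].
  by rewrite (og_fun qu (og0 q)) (og_fun pv (og0 p)) addr0.
- have [_ _ _ [s [y [rs qs]]]] := ographP q.
  have [t [z [rt pz]]] := og_dense p s.
  exists (t * s), (t * y + z); split; first exact: regularM.
  by exists (t * y), z; split=> //; apply: ogZ.
by exists q' => x y z qx px; apply: qF; exists y, z.
Qed.

Lemma omul_subproof q p :
  exists q', forall x y z, q x y -> p y z -> q' x z.
Proof.
have [|||q' qF] :=
  @ograph_extend (fun x z => exists2 y, q x y & p y z).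
- move=> r x y x' y' [u qx pu] [u' qx' pu'].
  by exists (r * u + u'); apply: ogD => //; apply: ogZ.
- move=> y [u qu]; rewrite (og_fun qu (og0 q)) => py.
  exact: (og_fun py (og0 p)).
- have [_ _ _ [s [y [rs qs]]]] := ographP q.
  have [t [z [rt pz]]] := og_dense p y.
  exists (t * s), z; split; first exact: regularM.
  by exists (t * y) => //; apply: ogZ.
by exists q' => x y z qx px; apply: qF; exists y.
Qed.

Definition oinj a : Q := sval (cid (oinj_subproof a)).
Definition oadd q p : Q := sval (cid (oadd_subproof q p)).
Definition omul q p : Q := sval (cid (omul_subproof q p)).
Definition oopp q : Q := omul q (oinj (-1)).

Lemma oinjP a x : oinj a x (x * a).
Proof. by rewrite /oinj; case: cid => q /=; apply. Qed.

Lemma oinjE a x y : y = x * a -> oinj a x y.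
Proof. by move->; apply: oinjP. Qed.

Lemma oaddP q p x y z : q x y -> p x z -> oadd q p x (y + z).
Proof. by rewrite /oadd; case: cid => q' /=; apply. Qed.

Lemma omulP q p y x z : q x y -> p y z -> omul q p x z.
Proof. by rewrite /omul; case: cid => q' /=; apply. Qed.

Lemma ooppP q x y : q x y -> oopp q x (- y).
Proof. by move=> qx; apply: (omulP qx); apply: oinjE; rewrite mulrN1. Qed.

Lemma og_common q p : exists s y z, [/\ regular s, q s y & p s z].
Proof.
have [_ _ _ [s [y [rs qs]]]] := ographP q.
have [t [z [rt pz]]] := og_dense p s.
by exists (t * s), (t * y), z; split=> //; [apply: regularM|apply: ogZ].
Qed.

Lemma og_common3 q p q' :
  exists s x y z, [/\ regular s, q s x, p s y & q' s z].
Proof.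
have [s [y [z [rs qs ps]]]] := og_common q p.
have [t [w [rt qw]]] := og_dense q' s.
exists (t * s), (t * y), (t * z), w.
by split=> //; [apply: regularM|apply: ogZ|apply: ogZ].
Qed.

Lemma og_chain q p : exists s y z, [/\ regular s, q s y & p y z].
Proof.
have [_ _ _ [s [y [rs qs]]]] := ographP q.
have [t [z [rt pz]]] := og_dense p y.
by exists (t * s), (t * y), z; split=> //; [apply: regularM|apply: ogZ].
Qed.

Lemma oaddC : commutative oadd.
Proof.
move=> q p; have [s [y [z [rs qs ps]]]] := og_common q p.
by apply: (ograph_ext rs (oaddP qs ps)); rewrite addrC; apply: oaddP.
Qed.

Lemma oaddA : associative oadd.
Proof.
move=> q p q'; have [s [x [y [z [rs qs ps qs']]]]] := og_common3 q p q'.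
apply: (ograph_ext rs (oaddP qs (oaddP ps qs'))).
by rewrite addrA; do ?apply: oaddP.
Qed.

Lemma oadd0 : left_id (oinj 0) oadd.
Proof.
move=> q; have [_ _ _ [s [y [rs qs]]]] := ographP q.
by have := oaddP (oinjP 0 s) qs; rewrite mulr0 add0r => /(ograph_ext rs); apply.
Qed.

Lemma oaddN : left_inverse (oinj 0) oopp oadd.
Proof.
move=> q; have [_ _ _ [s [y [rs qs]]]] := ographP q.
apply: (ograph_ext rs (oaddP (ooppP qs) qs)).
by apply: oinjE; rewrite addNr mulr0.
Qed.

HB.instance Definition _ := GRing.isZmodule.Build Q oaddA oaddC oadd0 oaddN.

Lemma omulA : associative omul.
Proof.
move=> q p q'; have [s [x [y [rs qs px]]]] := og_chain q p.
have [t [z [rt qy]]] := og_dense q' y.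
apply: (ograph_ext (regularM rt rs) (y := z)).
  by apply: (omulP (ogZ t qs)); apply: (omulP (ogZ t px)).
by apply: omulP qy; apply: (omulP (ogZ t qs)); apply: ogZ.
Qed.

Lemma omul1 : left_id (oinj 1) omul.
Proof.
move=> q; have [_ _ _ [s [y [rs qs]]]] := ographP q.
by apply: (ograph_ext rs _ qs); apply: omulP qs; apply: oinjE; rewrite mulr1.
Qed.

Lemma omulr1 : right_id (oinj 1) omul.
Proof.
move=> q; have [_ _ _ [s [y [rs qs]]]] := ographP q.
by apply: (ograph_ext rs _ qs); apply: (omulP qs); apply: oinjE; rewrite mulr1.
Qed.

Lemma omulDl : left_distributive omul oadd.
Proof.
move=> q p q'; have [s [x [y [rs qs ps]]]] := og_common q p.
have [t [z [rt qx]]] := og_dense q' x.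
have [u [w [ru qy]]] := og_dense q' (t * y).
apply: (ograph_ext (regularM ru (regularM rt rs)) (y := u * z + w)).
  apply: (omulP (y := u * (t * (x + y)))); first by do 2!apply: ogZ; apply: oaddP.
  by rewrite !mulrDr; apply: ogD => //; apply: ogZ.
apply: oaddP; first by apply: omulP (ogZ u qx); do 2!apply: ogZ.
by apply: omulP qy; do 2!apply: ogZ.
Qed.

Lemma omulDr : right_distributive omul oadd.
Proof.
move=> q p q'; have [s [x [y [rs qs px]]]] := og_chain q p.
have [t [z [rt qx]]] := og_dense q' x.
apply: (ograph_ext (regularM rt rs) (y := t * y + z)).
  by apply: (omulP (ogZ t qs)); apply: oaddP => //; apply: ogZ.
by apply: oaddP; apply: (omulP (ogZ t qs)); [apply: ogZ|].
Qed.

Lemma oinj_inj : injective oinj.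
Proof.
move=> a b ab; have := oinjP a 1; rewrite ab => /og_fun/(_ (oinjP b 1)).
by rewrite !mul1r.
Qed.

Lemma oone_neq0 : oinj 1 != 0 :> Q.
Proof. by apply/eqP => /oinj_inj/eqP; rewrite oner_eq0. Qed.

HB.instance Definition _ := GRing.Zmodule_isNzRing.Build Q
  omulA omul1 omulr1 omulDl omulDr oone_neq0.

Lemma oinjB : zmod_morphism oinj.
Proof.
move=> a b; apply: (ograph_ext (regular1 A) (oinjP (a - b) 1)).
by rewrite mulrBr; apply: oaddP; [apply: oinjP|apply: ooppP; apply: oinjP].
Qed.

Lemma oinjM : monoid_morphism oinj.
Proof.
split=> // a b; apply: (ograph_ext (regular1 A) (oinjP (a * b) 1)).
by rewrite mulrA; apply: omulP (oinjP _ _); apply: oinjP.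
Qed.

HB.instance Definition _ := GRing.isZmodMorphism.Build A Q oinj oinjB.
HB.instance Definition _ := GRing.isMonoidMorphism.Build A Q oinj oinjM.

Lemma oinj_unit s : regular s -> exists t : Q, t * oinj s = 1 /\ oinj s * t = 1.
Proof.
move=> rs.
(* The inverse of [s] is the partial map [y s |-> y]. *)
have [|||q qF] := @ograph_extend (fun x y => x = y * s).
- by move=> r _ y _ y' -> ->; rewrite mulrDl mulrA.
- by move=> y ys; apply: rs.2; rewrite mul0r.
- by exists s, 1; rewrite mul1r.
have qs : q s 1 by apply: qF; rewrite mul1r.
exists q; split.
  apply: (ograph_ext rs (y := s)); last by apply: oinjE; rewrite mulr1.
  by apply: (omulP qs); apply: oinjE; rewrite mul1r.
apply: (ograph_ext (regular1 A) (y := 1)); last by apply: oinjE; rewrite mulr1.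
by apply: omulP qs; apply: oinjE; rewrite mul1r.
Qed.

Lemma oinj_denominator (q : Q) :
  exists s a, regular s /\ oinj s * q = oinj a.
Proof.
have [_ _ _ [s [a [rs qs]]]] := ographP q; exists s, a; split=> //.
apply: (ograph_ext (regular1 A) (y := a)); last by apply: oinjE; rewrite mul1r.
by apply: omulP qs; apply: oinjE; rewrite mul1r.
Qed.

End OreRing.

(** * The ring of quotients as an algebra *)

Section OreAlgebra.
Variables (k : fieldType) (A : algType k).
Hypothesis primeA : forall a b : A, (forall x, a * x * b = 0) -> a = 0 \/ b = 0.
Hypothesis noethA : left_noetherian A.
Local Notation Q := (ore_quotient primeA noethA).
Local Notation inj := (@oinj A primeA noethA).
Implicit Types (q p : Q) (a b : k).

Definition oscale a q : Q := inj a%:A * q.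

Lemma oscalar_comm a q : inj a%:A * q = q * inj a%:A.
Proof.
have [_ _ _ [s [y [rs qs]]]] := ographP q.
apply: (ograph_ext rs (y := a *: y)).
  have -> : a *: y = a%:A * y by rewrite mulr_algl.
  by apply: omulP (ogZ a%:A qs); apply: oinjE; rewrite mulr_algl mulr_algr.
by apply: (omulP qs); apply: oinjE; rewrite mulr_algr.
Qed.

Lemma oscaleA a b q : oscale a (oscale b q) = oscale (a * b) q.
Proof. by rewrite /oscale mulrA -rmorphM /= mulr_algl scalerA. Qed.

Lemma oscale1 : left_id 1 oscale.
Proof. by move=> q; rewrite /oscale scale1r rmorph1 mul1r. Qed.

Lemma oscaleDr : right_distributive oscale +%R.
Proof. by move=> a q p; rewrite /oscale mulrDr. Qed.

Lemma oscaleDl q : {morph oscale^~ q : a b / a + b}.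
Proof. by move=> a b; rewrite /oscale scalerDl rmorphD mulrDl. Qed.

HB.instance Definition _ := GRing.Zmodule_isLmodule.Build k Q
  oscaleA oscale1 oscaleDr oscaleDl.

Lemma oscaleAl (a : k) q p : a *: (q * p) = (a *: q) * p.
Proof. exact: mulrA. Qed.

HB.instance Definition _ := GRing.Lmodule_isLalgebra.Build k Q oscaleAl.

Lemma oscaleAr (a : k) q p : a *: (q * p) = q * (a *: p).
Proof.
rewrite -[LHS]/(inj a%:A * (q * p)) -[a *: p]/(inj a%:A * p).
by rewrite !mulrA oscalar_comm.
Qed.

HB.instance Definition _ := GRing.Lalgebra_isAlgebra.Build k Q oscaleAr.

Lemma oinjZ : scalable inj.
Proof. by move=> a x; rewrite -[RHS]/(inj a%:A * inj x) -rmorphM /= mulr_algl. Qed.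

HB.instance Definition _ := GRing.isScalable.Build k A Q *:%R inj oinjZ.

Theorem goldie_theorem :
  exists (Q : algType k) (j : {lrmorphism A -> Q}), goldie_quotient_ring j.
Proof.
exists Q, inj; split.
- exact: oinj_inj.
- exact: oinj_unit.
- exact: oinj_denominator.
Qed.

End OreAlgebra.

(** * Rational ideals *)

Lemma horner_alg_sum (k : fieldType) (A : algType k) (a : A) (p : {poly k}) n :
  (size p <= n)%N -> horner_alg a p = \sum_(i < n) p`_i *: a ^+ i.
Proof.
move=> pn; rewrite /horner_alg /horner_morph (@horner_coef_wide _ n).
  by apply: eq_bigr => i _; rewrite coef_map mulr_algl.
by apply: leq_trans pn; exact: size_poly.
Qed.

Section Rational.
Variables (k : fieldType) (R : algType k) (P : spec R).
Hypothesis noethR : left_noetherian R.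
Local Notation A := (factor P).
Local Notation pi := (factor_pi P).

Lemma factor_pi0 x : pi x = 0 <-> spec_ideal P x.
Proof. by rewrite -(raddf0 pi) factor_piP subr0. Qed.

Lemma factor_prime (a b : A) : (forall x, a * x * b = 0) -> a = 0 \/ b = 0.
Proof.
have [x <-] := factor_pi_surj a; have [y <-] := factor_pi_surj b => xy.
have [_ _ pP] := (prime_idealP _).1 (spec_prime P).
by rewrite !factor_pi0; apply: pP => z; rewrite -factor_pi0 !rmorphM.
Qed.

Lemma factor_noetherian : left_noetherian A.
Proof.
move=> I lI II.
have [n|n x /=|N IN] := noethR (I := fun n => [set x | I n (pi x)]).
- have [I0 ID] := lI n; split; rewrite /= ?raddf0 // => a u v /= Iu Iv.
  have -> : pi (a *: u + v) = pi a * pi u + pi v.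
    by rewrite factor_piD; congr (_ + _); apply: factor_piM.
  exact: ID.
- exact: II.
- exists N => n Nn; apply/seteqP; split=> q; have [x <-] := factor_pi_surj q.
    by move=> Ix; have : [set x | I n (pi x)] x by []; rewrite IN.
  by move=> Ix; have : [set x | I N (pi x)] x by []; rewrite -(IN n).
Qed.

(** The ratio [a / s] is realised as a central element [z] of [Q]; a polynomial relation for [z],
    cleared of denominators, is the required relation in [R]. *)
Lemma rational_algebraic_centroid : rational P -> algebraic_centroid P.
Proof.
move=> [Q [j [[inj_j junit jden] algQ]]] s a nPs sa.
have [lift liftK] := choice (@factor_pi_surj _ _ P).
have s0 : pi s <> 0 by rewrite factor_pi0.
have cancel_s (x : A) : (forall y, x * y * pi s = 0) -> x = 0.
  by move=> /factor_prime[].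
have saE (x : A) : pi a * x * pi s = pi s * x * pi a.
  have [y <-] := factor_pi_surj x.
  by have /factor_piP := sa y; rewrite !rmorphM.
(* [E] is the ideal of denominators of [a / s]: [d] plays the role of [c (a / s)]. It is nonzero,
   since it contains [s], so it has a regular element [c]. *)
pose E := [set c : A | exists d, forall x, d * x * pi s = c * x * pi a].
have iE : ideal E.
  split.
  - by exists 0 => x; rewrite !mul0r.
  - move=> x y [d dx] [e ey]; exists (d + e) => z.
    by rewrite !mulrDl dx ey.
  - move=> r x [d dx]; exists (r * d) => z.
    by rewrite -!mulrA !(mulrA d) dx !mulrA.
  - by move=> r x [d dx]; exists (d * r) => z; rewrite -!(mulrA _ r) dx.
have [|c [d dE] rc] := ideal_regular factor_prime factor_noetherian iE.
  by exists (pi s) => //; exists (pi a) => x.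
have dc x : d * x * c = c * x * d.
  apply/eqP; rewrite -subr_eq0; apply/eqP/cancel_s => y; rewrite !mulrBl.
  have -> : d * x * c * y * pi s = d * (x * c * y) * pi s by rewrite !mulrA.
  have -> : c * x * d * y * pi s = c * x * (d * y * pi s) by rewrite !mulrA.
  by rewrite !dE !mulrA subrr.
have [t [tc ct]] := junit c rc.
have dcj x : j d * j x * j c = j c * j x * j d by rewrite -!rmorphM dc.
have dcj1 : j d * j c = j c * j d by have := dcj 1; rewrite rmorph1 !mulr1.
pose z := t * j d.
have dt : j d * t = z.
  by rewrite /z -[LHS]mul1r -tc -!mulrA (mulrA (j c)) -dcj1 -mulrA ct mulr1.
have zj x : z * j x = j x * z.
  rewrite -dt -[LHS]mulr1 -ct !mulrA.
  rewrite -(mulrA (j d)).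
  have -> : j d * (t * j x) * j c * t = t * (j d * j x * j c) * t.
    by rewrite mulrA dt /z !mulrA.
  by rewrite dcj !mulrA tc mul1r.
have jcz : j c * z = j d by rewrite /z mulrA ct mul1r.
clearbody z.
have cz : center z.
  move=> q; have [s' [b [rs' qE]]] := jden q; have [t' [ts st]] := junit s' rs'.
  have zt : z * t' = t' * z.
    by rewrite -[LHS]mul1r -ts -!mulrA (mulrA (j s')) -zj -mulrA st mulr1.
  have -> : q = t' * j b by rewrite -qE mulrA ts mul1r.
  by rewrite mulrA zt -!mulrA zj.
have [p p0 pz] := algQ z cz; pose n := size p.
have cdE l : j c ^+ l * z ^+ l = j d ^+ l.
  rewrite -exprMn_comm; last exact/esym/zj.
  by rewrite jcz.
(* In [Q] these terms are [c ^ n * z ^ l]: the powers of [z] with the common denominator [c ^ n]. *)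
exists n, (fun l => p`_l), (fun l => lift (c ^+ (n - l) * d ^+ l)); split.
- exists n.-1; first by rewrite prednK ?leqnn // lt0n size_poly_eq0.
  by rewrite -lead_coefE lead_coef_eq0.
- move=> l ln x; apply/factor_piP; rewrite !rmorphM /= !liftK.
  have -> : c ^+ (n - l.+1) * d ^+ l.+1 * pi x * pi s
      = c ^+ (n - l.+1) * d ^+ l * (d * pi x * pi s) by rewrite exprSr !mulrA.
  have dlc : d ^+ l * c = c * d ^+ l.
    by apply/esym/commrX; have := dc 1; rewrite !mulr1 => /esym.
  have -> : (n - l = (n - l.+1).+1)%N by rewrite subnSK // ltnW.
  by rewrite dE exprSr !mulrA -(mulrA _ _ c) dlc !mulrA.
- rewrite -factor_pi0 liftK subn0 mulr1.
  have: forall m, c ^+ m <> 0.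
    elim=> [|m IHm]; first by apply/eqP; rewrite oner_eq0.
    rewrite exprSr => cm; apply: IHm; apply: rc.2; rewrite cm mul0r //.
  by apply.
- rewrite -factor_pi0 raddf_sum; apply: inj_j; rewrite raddf0 raddf_sum /=.
  transitivity (j c ^+ n * horner_alg z p); last by rewrite pz mulr0.
  rewrite (@horner_alg_sum _ _ _ _ n) // mulr_sumr; apply: eq_bigr => l _.
  rewrite linearZ /= linearZ liftK -scalerAr; congr (_ *: _).
  by rewrite rmorphM !rmorphXn /= -cdE mulrA -exprD subnK // ltnW.
Qed.

(** Centrality of [z = s^-1 a] makes [a] and [s] proportional. A progression with this ratio maps to
    [u 0 * z ^ l] in [Q], so [u 0] annihilates the central element [p(z)]. *)
Lemma algebraic_centroid_rational : algebraic_centroid P -> rational P.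
Proof.
move=> algP; have [Q [j gQ]] := goldie_theorem factor_prime factor_noetherian.
exists Q, j; split=> // z cz; have [inj_j junit jden] := gQ.
have [s' [a' [rs sz]]] := jden z.
have [s sE] := factor_pi_surj s'; have [a aE] := factor_pi_surj a'; subst.
have [t [ts st]] := junit _ rs.
have cancel_s (x : Q) : x * j (pi s) = 0 -> x = 0.
  by move=> xs; rewrite -[x]mulr1 -st mulrA xs mul0r.
have nPs : ~ spec_ideal P s.
  rewrite -factor_pi0 => s0; have := oner_neq0 Q.
  by rewrite -st s0 raddf0 mul0r eqxx.
have sa : proportional P s a.
  move=> x; apply/factor_piP; apply: inj_j; rewrite !rmorphM /= -sz.
  by rewrite -!mulrA; congr (_ * _); rewrite cz mulrA.
have [n [c [u [[l0 l0n cl0] pu nPu0 cu]]]] := algP s a nPs sa.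
have uz l : (l < n)%N -> j (pi (u l)) = j (pi (u 0%N)) * z ^+ l.
  elim: l => [|l IHl] ln; first by rewrite mulr1.
  have := pu l ln 1; rewrite !mulr1 => /factor_piP; rewrite !rmorphM => E.
  have := congr1 j E; rewrite !rmorphM /= -sz (IHl (ltnW ln)) => {}E.
  apply/eqP; rewrite -subr_eq0; apply/eqP/cancel_s; rewrite mulrBl E.
  by rewrite exprSr -!mulrA -cz subrr.
pose p := \poly_(l < n) c l; exists p.
  apply/eqP => /(congr1 (fun q : {poly k} => q`_l0)).
  by rewrite coef_poly l0n coef0 => /eqP; rewrite (negPf cl0).
have pzE : horner_alg z p = \sum_(l < n) c l *: z ^+ l.
  rewrite (@horner_alg_sum _ _ _ _ n) ?size_poly //.
  by apply: eq_bigr => l _; rewrite coef_poly ltn_ord.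
set w := horner_alg z p in pzE *.
have cw x : w * x = x * w.
  rewrite pzE mulr_suml mulr_sumr; apply: eq_bigr => l _.
  rewrite -scalerAl -scalerAr; congr (_ *: _); apply/esym/commrX.
  exact/esym/cz.
have uw : j (pi (u 0%N)) * w = 0.
  transitivity (j (pi (\sum_(l < n) c l *: u l))); last first.
    by rewrite (factor_pi0 _).2 // raddf0.
  rewrite pzE mulr_sumr raddf_sum raddf_sum /=; apply: eq_bigr => l _.
  by rewrite -scalerAr -uz // linearZ /= linearZ.
(* Primeness is available in [R / P] only, so [w] is first multiplied by a denominator [r]. *)
have [r [b [rr rw]]] := jden w.
have [||b0] := @factor_prime (pi (u 0%N)) b.
- move=> x; apply: inj_j; rewrite raddf0 !rmorphM /= -rw.
  by rewrite -(cw (j r)) mulrA -(mulrA (j _) (j x)) -(cw (j x)) mulrA uw !mul0r.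
- by move/factor_pi0.
have [t' [tr rt]] := junit _ rr.
by rewrite -[w]mul1r -tr -mulrA rw b0 raddf0 mulr0.
Qed.

Lemma rationalP : rational P <-> algebraic_centroid P.
Proof.
split; [exact: rational_algebraic_centroid|exact: algebraic_centroid_rational].
Qed.

End Rational.

(** * Morita contexts *)

Section MoritaContext.
Variables (k : fieldType) (R S : algType k) (X Y : Type).

(* T m n s = m s n and T' n m r = n r m, for elements m, n of the bimodules of
   a Morita context. *)
Definition context_compatible (T : X -> Y -> {linear S -> R})
    (T' : Y -> X -> {linear R -> S}) : Prop :=
  forall m n m' n' s r s',
    T m n' (s * T' n m' r * s') = T m n s * r * T m' n' s'.

End MoritaContext.

Section Contraction.
Variables (k : fieldType) (R S : algType k) (X Y : Type).
Variables (T : X -> Y -> {linear S -> R}).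
Implicit Types (P : set R).

(** The factors [x] and [y] make this a two-sided ideal when [P] is one, although [X] and [Y] are
    bare index types without an action of [S]. *)
Definition contraction P : set S :=
  [set s | forall m n x y, P (T m n (x * s * y))].

Lemma contraction_sub P Q : P `<=` Q -> contraction P `<=` contraction Q.
Proof. by move=> PQ s Ps m n x y; apply/PQ/Ps. Qed.

Lemma contraction_ideal P : ideal P -> ideal (contraction P).
Proof.
move=> [P0 PD _ _]; split=> [|s t Ps Pt|r s Ps|r s Ps] m n x y.
- by rewrite mulr0 mul0r linear0.
- by rewrite mulrDr mulrDl linearD; apply: PD; [apply: Ps|apply: Pt].
- by rewrite mulrA; apply: Ps.
- by rewrite mulrA -mulrA; apply: Ps.
Qed.

End Contraction.

Section Transfer.
Variables (k : fieldType) (R S : algType k) (X Y : Type).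
Variables (T : X -> Y -> {linear S -> R}) (T' : Y -> X -> {linear R -> S}).
Hypotheses (TT' : context_compatible T T') (T'T : context_compatible T' T).
Variable P : set R.
Hypotheses (primeP : prime_ideal P) (TP : exists m n s, ~ P (T m n s)).
Local Notation P' := (contraction T P).
Let iP : ideal P. Proof. by have [] := primeP. Qed.

(** A product [T(a) r T(b)] is, by [TT'], a single value of [T] at an element in which [a] and [b]
    occur with a factor from [S] between them. *)
Lemma contraction_prime : prime_ideal P'.
Proof.
apply/prime_idealP; split.
- exact: contraction_ideal.
- move=> P1; have [m [n [s]]] := TP; apply.
  by rewrite -[s]mulr1 -[s]mulr1; apply: P1.
- move=> a b ab; apply: contrapT => /not_orP[].
  move=> /existsNP[m /existsNP[n /existsNP[x /existsNP[y xay]]]].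
  move=> /existsNP[m' /existsNP[n' /existsNP[x' /existsNP[y' xby]]]].
  have [r] := prime_mulP primeP xay xby; apply; rewrite -TT'.
  have -> : x * a * y * T' n m' r * (x' * b * y') =
      x * (a * (y * T' n m' r * x') * b) * y' by rewrite !mulrA.
  exact: ab.
Qed.

Lemma contraction_nontrivial : exists n m r, ~ P' (T' n m r).
Proof.
have [m [n [s nPs]]] := TP; have [r nPr] := prime_mulP primeP nPs nPs.
by exists n, m, r => /(_ m n s s); rewrite TT'.
Qed.

(** Let [t = T m n s] be outside [P]. If [r] is outside [P] too, then so is [t x r y t] for suitable
    [x] and [y]; by [TT'] this is the value of [T] at [s * T' n m (x r y) * s]. *)
Lemma contractionK : contraction T' P' = P.
Proof.
have [_ _ PM PMr] := iP; apply/seteqP; split=> r Pr.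
  apply: contrapT => nPr; have [m [n [s nPs]]] := TP.
  have [x] := prime_mulP primeP nPs nPr.
  move=> /(prime_mulP primeP)/(_ nPs)[y]; apply.
  have := Pr n m x y m n s s; rewrite TT'; congr P.
  by rewrite !mulrA.
by move=> n m x y m' n' s s'; rewrite TT'; apply/PMr/PM/PMr/PM.
Qed.

Lemma contraction_primitive : primitive_ideal P -> primitive_ideal P'.
Proof.
move=> /primitive_idealP[I [lI nI1 mxI] PE]; apply/primitive_idealP.
have [m0 [n0 [s0]]] := TP; rewrite {1}PE => /existsNP[x0 nI0].
have [r0 Ir0] := mxI _ nI0.
(* [J] is the annihilator of the class of [n0 (x) x0] in the tensor product of [N] with [R / I],
   modulo the elements that [M] kills; [x0] and [n0] are chosen to make this class nonzero. *)
pose J := [set s : S | forall (m : X) (y : S), I (T m n0 (y * s) * x0)].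
have lJ : left_ideal J.
  split=> [m y|a s t Js Jt m y].
    by rewrite mulr0 linear0 mul0r; have [] := lI.
  rewrite mulrDr linearD mulrDl; apply: (left_idealD lI); last exact: Jt.
  by have := Js m (y * a); rewrite -mulrA.
exists J; first split=> //.
- by move=> /(_ m0 s0); rewrite mulr1.
- move=> s /existsNP[m /existsNP[y nIs]].
  have [r Ir] := mxI _ nIs; exists (T' n0 m (x0 * r) * y) => m' z.
  have -> : z * (1 - T' n0 m (x0 * r) * y * s) =
      z - z * T' n0 m (x0 * r) * (y * s) by rewrite mulrBr mulr1 !mulrA.
  rewrite linearB mulrBl TT'.
  have -> : T m' n0 z * x0 - T m' n0 z * (x0 * r) * T m n0 (y * s) * x0 =
      T m' n0 z * x0 * (1 - r * (T m n0 (y * s) * x0)).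
    by rewrite mulrBr mulr1 !mulrA.
  exact: left_idealM.
- apply/seteqP; split=> [s P's x m y|s Js m n x y].
    by have := P's m n0 y x; rewrite PE mulrA; apply.
  rewrite PE => z.
  have -> : T m n (x * s * y) * z =
      T m n (x * s * y) * z * (1 - r0 * (T m0 n0 s0 * x0)) +
      T m n0 (x * (s * (y * T' n m0 (z * r0) * s0))) * x0.
    have -> : x * (s * (y * T' n m0 (z * r0) * s0)) =
        x * s * y * T' n m0 (z * r0) * s0 by rewrite !mulrA.
    by rewrite TT' mulrBr mulr1 !mulrA subrK.
  by apply: left_idealD => //; [apply: left_idealM|apply: Js].
Qed.

(** The ratio is pushed to [R] as [a1 / s1] through [T], and a progression found there is pulled
    back through [T']. *)
Lemma contraction_algebraic_centroid :
  algebraic_centroid P -> algebraic_centroid P'.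
Proof.
move=> algP s a; rewrite /contraction /=.
move=> /existsNP[m0 /existsNP[n0 /existsNP[x0 /existsNP[y0 nPs]]]] sa.
have iP' : ideal P' by exact: contraction_ideal.
pose s1 := T m0 n0 (x0 * s * y0); pose a1 := T m0 n0 (x0 * a * y0).
have sa1 : proportional P s1 a1.
  move=> r; rewrite /s1 /a1 -!TT' -linearB.
  have := sa (y0 * T' n0 m0 r * x0) m0 n0 x0 y0; congr (P (T _ _ _)).
  by rewrite mulrBr mulrBl !mulrA.
have [n [c [u [nc pu nPu cu]]]] := algP s1 a1 nPs sa1.
move: nPu; rewrite -{1}contractionK.
move=> /existsNP[n1 /existsNP[m1 /existsNP[x1 /existsNP[y1 nPu]]]].
exists n, c, (fun l => T' n1 m1 (x1 * u l * y1)); split=> //.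
- move=> l ln x m n' z z'.
  (* After multiplication by [r * s1] the relation is a composite of two replacements: [s] by [a]
     with a step down in [u], from [pu], and [s w a] by [a w s], from [sa]. *)
  apply: (prime_cancel primeP nPs) => r; rewrite -TT'.
  pose w := z' * T' n' m0 r * x0.
  pose v b l := T' n1 m1 (x1 * u l * y1) * (x * s * w) * b.
  have vE b i : T m n0 (z * v b i * y0) =
      T m n1 z * x1 * (u i * (y1 * T m1 n' (x * s * z') * r) *
        T m0 n0 (x0 * b * y0)).
    have -> : z * v b i * y0 = z * T' n1 m1 (x1 * u i * y1) *
        ((x * s * z') * T' n' m0 r * (x0 * b * y0)).
      by rewrite /v /w !mulrA.
    by rewrite !TT' !mulrA.
  apply/(congP iP (y := T m n0 (z * (v s l.+1 - v a l) * y0))); last first.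
    rewrite mulrBr mulrBl linearB !vE -mulrBr.
    by have [_ _ PM _] := iP; apply: PM; apply: pu.
  apply: cong_sym => //; rewrite -linearB.
  have := sa w m n0 (z * T' n1 m1 (x1 * u l * y1) * x) y0; congr (P (T _ _ _)).
  rewrite /v /w !(mulrBl, mulrBr) !mulrA.
  by rewrite opprD opprK addrACA subrr add0r addrC.
- have cuP' : contraction T' P' (\sum_(l < n) c l *: u l) by rewrite contractionK.
  have := cuP' n1 m1 x1 y1; congr P'.
  rewrite mulr_sumr mulr_suml linear_sum; apply: eq_bigr => l _.
  by rewrite -scalerAr -scalerAl linearZ.
Qed.

End Transfer.

Section TransferLocallyClosed.
Variables (k : fieldType) (R S : algType k) (X Y : Type).
Variables (T : X -> Y -> {linear S -> R}) (T' : Y -> X -> {linear R -> S}).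
Hypotheses (TT' : context_compatible T T') (T'T : context_compatible T' T).

(** A prime strictly above the contraction either contains all values of [T'], hence the witness, or
    contracts to a prime strictly above [P], which contains [r]. *)
Lemma contraction_locally_closed (P : set R) : prime_ideal P ->
  (exists m n s, ~ P (T m n s)) ->
  locally_closed_ideal P -> locally_closed_ideal (contraction T P).
Proof.
move=> pP TP [r]; rewrite -{1}(contractionK TT' pP TP).
move=> /existsNP[n /existsNP[m /existsNP[x /existsNP[y nPr]]]] hr.
exists (T' n m (x * r * y)) => // Q' pQ' PQ' nQ'.
have [T'Q'|nT'Q'] := pselect (forall n m r, Q' (T' n m r)); first exact: T'Q'.
have {}nT'Q' : exists n m r, ~ Q' (T' n m r).
  move: nT'Q' => /existsNP[n' /existsNP[m' /existsNP[r' h]]].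
  by exists n', m', r'.
suff : contraction T' Q' r by apply.
apply: hr; first exact: (contraction_prime T'T pQ' nT'Q').
  by rewrite -(contractionK TT' pP TP); apply: contraction_sub.
move=> Q'P; apply: nQ'; rewrite -(contractionK T'T pQ' nT'Q').
exact: contraction_sub.
Qed.

End TransferLocallyClosed.

Definition dixmier_moeglin_at (k : fieldType) (R : algType k)
    (P : set R) : Prop :=
  (locally_closed_ideal P <-> primitive_ideal P) /\
  (primitive_ideal P <-> algebraic_centroid P).

Lemma contraction_dixmier_moeglin (k : fieldType) (R S : algType k) (X Y : Type)
    (T : X -> Y -> {linear S -> R}) (T' : Y -> X -> {linear R -> S}) :
  context_compatible T T' -> context_compatible T' T ->
  (forall P : set R, prime_ideal P -> dixmier_moeglin_at P) ->
  forall P' : set S, prime_ideal P' -> (exists n m r, ~ P' (T' n m r)) ->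
  dixmier_moeglin_at P'.
Proof.
move=> TT' T'T dmR P' pP' T'P'.
pose P := contraction T' P'.
have pP : prime_ideal P by apply: contraction_prime.
have TP : exists m n s, ~ P (T m n s) by apply: contraction_nontrivial.
have PK : contraction T P = P' by exact: contractionK.
have lcE : locally_closed_ideal P <-> locally_closed_ideal P'.
  split; last exact: contraction_locally_closed.
  by rewrite -PK; apply: contraction_locally_closed.
have prE : primitive_ideal P <-> primitive_ideal P'.
  split; last exact: contraction_primitive.
  by rewrite -PK; apply: contraction_primitive.
have acE : algebraic_centroid P <-> algebraic_centroid P'.
  split; last exact: contraction_algebraic_centroid.
  by rewrite -PK; apply: contraction_algebraic_centroid.
by rewrite /dixmier_moeglin_at -lcE -prE -acE; apply: dmR.
Qed.

(** * Corners *)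

Lemma dixmier_moeglinP (k : fieldType) (R : algType k) : left_noetherian R ->
  dixmier_moeglin R <->
  (forall P : set R, prime_ideal P -> dixmier_moeglin_at P).
Proof.
move=> noethR; split=> [[_ dmR] P pP|dmR].
  have := dmR (Spec pP); rewrite /dixmier_moeglin_at.
  by rewrite locally_closedP rationalP.
split=> // P; rewrite locally_closedP rationalP //.
exact: dmR (spec_prime P).
Qed.

Section CornerContext.
Variables (k : fieldType) (R : algType k) (e : R).
Hypotheses (e_idem : e * e = e) (e_neq0 : e != 0).
Local Notation eRe := (corner e_idem e_neq0).

(** [m] and [n] stand for [m e] in [R e] and [e n] in [e R], so both bimodules are indexed by
    [R]. *)
Definition corner_out (m n : R) (s : eRe) : R := m * corner_val s * n.

Lemma corner_out_linear m n : linear (corner_out m n).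
Proof.
move=> a s t; rewrite /corner_out /= mulrDr mulrDl.
by rewrite -scalerAr -scalerAl.
Qed.

HB.instance Definition _ m n := GRing.isLinear.Build k eRe R *:%R
  (corner_out m n) (corner_out_linear m n).

Lemma corner_in_subproof (r : R) : e * r * e \in corner_pred e.
Proof. by rewrite unfold_in !mulrA e_idem -!mulrA e_idem. Qed.

Definition corner_in (n m r : R) : eRe :=
  Corner e_idem e_neq0 (corner_in_subproof (n * r * m)).

Lemma corner_in_linear n m : linear (corner_in n m).
Proof.
move=> a s t; apply: val_inj => /=; rewrite !(mulrDr, mulrDl).
by rewrite -!(scalerAr, scalerAl).
Qed.

HB.instance Definition _ n m := GRing.isLinear.Build k R eRe *:%R
  (corner_in n m) (corner_in_linear n m).

Lemma corner_context :
  context_compatible (fun m n => corner_out m n) (fun n m => corner_in n m) /\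
  context_compatible (fun n m => corner_in n m) (fun m n => corner_out m n).
Proof.
split=> [m n m' n' s r s'|n m n' m' r s r'].
  rewrite /= /corner_out /= !mulrA; congr (_ * _).
  rewrite -!mulrA (mulrA _ e) corner_muler; do 4!congr (_ * _).
  by rewrite corner_mulel.
apply: val_inj; rewrite /= /corner_out !mulrA; congr (_ * _).
rewrite -!mulrA; do 4!congr (_ * _).
by rewrite (mulrA e) corner_mulel (mulrA _ e) corner_muler.
Qed.

(** [I n] is recovered, as its trace on [eRe], from the left ideal [J n] of the [r] with [e R r]
    inside [I n]. *)
Lemma corner_noetherian : left_noetherian R -> left_noetherian eRe.
Proof.
move=> noethR I lI II.
pose J n := [set r : R | forall x, exists2 y : eRe, I n y & corner_val y = e * x * r].
have [n|n r Jr x|N JN] := noethR J.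
- have [I0 ID] := lI n; split=> [x|a u v Ju Jv x]; first by exists 0; rewrite ?mulr0.
  have [y Iy yE] := Ju (x * a); have [z Iz zE] := Jv x.
  exists (y + z); first by rewrite -[y]mul1r; apply: (ID 1).
  by rewrite /= yE zE mulrDr !mulrA.
- by have [y Iy yE] := Jr x; exists y => //; apply: II.
have IJ n (s : eRe) : I n s <-> J n (corner_val s).
  split=> [Is x|/(_ 1)[y Iy]]; last first.
    by rewrite mulr1 corner_mulel => /val_inj <-.
  exists (corner_in 1 1 x * s).
    have [I0 ID] := lI n; rewrite -[_ * s]addr0; exact: (ID (corner_in 1 1 x)).
  by rewrite /= mul1r mulr1 -mulrA corner_mulel.
by exists N => n Nn; apply/seteqP; split=> s; rewrite !IJ JN.
Qed.

Lemma corner_dixmier_moeglin : dixmier_moeglin R -> dixmier_moeglin eRe.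
Proof.
move=> dmR; have noethR := dmR.1; have noethC := corner_noetherian noethR.
apply/dixmier_moeglinP => // P pP.
apply: (contraction_dixmier_moeglin corner_context.1 corner_context.2) => //.
  exact/dixmier_moeglinP.
exists 1, 1, 1 => P1; have /prime_idealP[_ + _] := pP; apply.
suff <- : corner_in 1 1 1 = 1 by [].
by apply: val_inj; rewrite /= !mulr1.
Qed.

End CornerContext.

(** * Morita equivalences *)

Section OrbitMap.
Variables (A : nzRingType) (M : lmodType A).

Definition orbit_map (m : M) (x : A^o) : M := (x : A) *: m.

Lemma orbit_map_linear m : linear (orbit_map m).
Proof. by move=> a x y; rewrite /orbit_map scalerDl -scalerA. Qed.

HB.instance Definition _ m := GRing.isLinear.Build A A^o M *:%R
  (orbit_map m) (orbit_map_linear m).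

Lemma linear_orbit_map (f : {linear A^o -> M}) : f =1 orbit_map (f 1).
Proof. by move=> x; rewrite /orbit_map -linearZ /= -[_ *: _]/(_ * 1) mulr1. Qed.

End OrbitMap.

Lemma linear_inverse (A : nzRingType) (M N : lmodType A) (f : {linear M -> N}) :
  bijective f -> exists2 g : {linear N -> M}, cancel f g & cancel g f.
Proof.
move=> [g fK gK]; have lg : linear g.
  by move=> a x y; apply: (can_inj fK); rewrite linearP !gK.
pose gl : {linear N -> M} := HB.pack g (GRing.isLinear.Build A N M *:%R g lg).
by exists gl.
Qed.

Section ModuleFunctor.
Variables (k : fieldType) (R S : algType k) (F : module_functor R S).
Implicit Types (M N : lmodType R).

(** This is [fmor_linear] at the scalar 0. *)
Lemma fmor_ext M N (f g : {linear M -> N}) : f =1 g -> fmor F f =1 fmor F g.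
Proof.
move=> fg x; rewrite (@fmor_linear _ _ _ F _ _ 0 f g f).
  by rewrite !scale0r add0r.
by move=> m; rewrite !scale0r add0r.
Qed.

Lemma fmor0 M N (f : {linear M -> N}) :
  (forall m, f m = 0) -> forall x, fmor F f x = 0.
Proof.
move=> f0 x; rewrite (@fmor_linear _ _ _ F _ _ (-1) f f f).
  by rewrite scaleNr scale1r scaleN1r addNr.
by move=> m; rewrite f0 scaler0 addr0.
Qed.

End ModuleFunctor.

Section UnitIsomorphism.
Variables (k : fieldType) (R S : algType k).
Variables (F : module_functor R S) (G : module_functor S R).
Variable eta : forall M : lmodType R, {linear M -> G (F M)}.
Hypotheses (eta_bij : forall M, bijective (eta M))
  (etaE : forall (M N : lmodType R) (f : {linear M -> N}),
      eta N \o f =1 fmor G (fmor F f) \o eta M).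

Lemma fmor_inj (M N : lmodType R) (f g : {linear M -> N}) :
  fmor F f =1 fmor F g -> f =1 g.
Proof.
move=> Ffg x; apply: (bij_inj (eta_bij N)).
by have := etaE f x; have := etaE g x => /= -> ->; apply: fmor_ext.
Qed.

(** The preimage is [fmor G phi] conjugated by [eta]. Naturality identifies its image under [G]
    after [F] with [fmor G phi], and faithfulness of [G] removes [G]. *)
Lemma fmor_full (M N : lmodType R) (phi : {linear F M -> F N}) :
  (forall (M' N' : lmodType S) (f g : {linear M' -> N'}),
    fmor G f =1 fmor G g -> f =1 g) ->
  exists f : {linear M -> N}, fmor F f =1 phi.
Proof.
move=> injG; have [eta' etaK eta'K] := linear_inverse (eta_bij N).
pose f : {linear M -> N} := eta' \o fmor G phi \o eta M.
exists f; apply: injG => y; have [e _ eK] := eta_bij M; rewrite -(eK y).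
by have /= <- := etaE f (e y); rewrite eta'K.
Qed.

End UnitIsomorphism.

(** * The Morita context of an equivalence *)

Section MoritaEquivalence.
Variables (k : fieldType) (R S : algType k).
Variables (F : module_functor R S) (G : module_functor S R).
Variables (eta : forall M : lmodType R, {linear M -> G (F M)}).
Variables (eps : forall M : lmodType S, {linear M -> F (G M)}).
Hypotheses (eta_bij : forall M, bijective (eta M))
  (etaE : forall (M N : lmodType R) (f : {linear M -> N}),
      eta N \o f =1 fmor G (fmor F f) \o eta M).
Hypotheses (eps_bij : forall M, bijective (eps M))
  (epsE : forall (M N : lmodType S) (f : {linear M -> N}),
      eps N \o f =1 fmor F (fmor G f) \o eps M).

Local Notation SS := (S^o : lmodType S).
Local Notation RR := (R^o : lmodType R).
(** The bimodules of the context are the progenerator [P = G S] and its [R]-dual; [S] acts on the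
    right of [P] by the images under [G] of right multiplications. *)
Local Notation P := (G SS).
Local Notation dual := {linear P -> RR}.
Local Notation rho s := (fmor G (@orbit_map S SS s : {linear SS -> SS})).

Let G_inj := fmor_inj eps_bij epsE.
Let F_inj := fmor_inj eta_bij etaE.

Lemma rho_inj (s t : S) : rho s =1 rho t -> s = t.
Proof.
move=> /G_inj/(_ 1); rewrite /= /orbit_map -![1 *: _]/(1 * _).
by rewrite !mul1r.
Qed.

Lemma rhoM (s t : S) p : rho (s * t) p = rho t (rho s p).
Proof.
rewrite -[RHS]/((rho t \o rho s) p) -fmor_comp; apply: fmor_ext => x.
exact: mulrA.
Qed.

Lemma rhoD (a : k) (s t : S) p : rho (a *: s + t) p = a%:A *: rho s p + rho t p.
Proof.
apply: fmor_linear => x /=; rewrite /orbit_map.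
rewrite -[LHS]/((x : S) * (a *: s + t)) mulrDr.
rewrite -[RHS]/(a%:A * ((x : S) * s) + (x : S) * t).
by rewrite -scalerAr mulr_algl.
Qed.

Definition morita_out (p : P) (h : dual) (s : S) : R := h (rho s p).

Lemma morita_out_linear p h : linear (morita_out p h).
Proof.
move=> a s t; rewrite /morita_out rhoD linearP.
by rewrite -[a%:A *: _]/(a%:A * _) mulr_algl.
Qed.

HB.instance Definition _ p h := GRing.isLinear.Build k S R *:%R
  (morita_out p h) (morita_out_linear p h).

(** By fullness of [G], the rank one endomorphism [p' |-> h(p') r p] of [P = G S] comes from an
    endomorphism of [S], which is a right multiplication. *)
Lemma morita_in_subproof (h : dual) (p : P) (r : R) :
  exists s : S, forall p', rho s p' = ((h p' : R) * r) *: p.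
Proof.
pose phi (p' : P) := ((h p' : R) * r) *: p.
have lphi : linear phi.
  move=> a x y; rewrite /phi linearP mulrDl scalerDl.
  by rewrite -[a *: h x]/(a * (h x : R)) -mulrA -scalerA.
pose phiL : {linear P -> P} :=
  HB.pack phi (GRing.isLinear.Build R P P *:%R phi lphi).
have [f fE] := fmor_full eps_bij epsE phiL F_inj.
exists (f 1) => p'; rewrite -[RHS]/(phiL p') -fE.
by apply: fmor_ext => x; apply/esym/(linear_orbit_map f).
Qed.

Definition morita_in h p r : S := sval (cid (morita_in_subproof h p r)).

Lemma morita_inE h p r p' : rho (morita_in h p r) p' = ((h p' : R) * r) *: p.
Proof. by rewrite /morita_in; case: cid => s /=; apply. Qed.

Lemma morita_in_linear h p : linear (morita_in h p).
Proof.
move=> a r r'; apply: rho_inj => p'; rewrite rhoD !morita_inE mulrDr scalerDl.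
by rewrite scalerA mulr_algl scalerAr.
Qed.

HB.instance Definition _ h p := GRing.isLinear.Build k R S *:%R
  (morita_in h p) (morita_in_linear h p).

Lemma morita_context :
  context_compatible (fun p h => morita_out p h) (fun h p => morita_in h p) /\
  context_compatible (fun h p => morita_in h p) (fun p h => morita_out p h).
Proof.
split=> [m n m' n' s r s'|n m n' m' r s r'] /=.
  by rewrite /morita_out !rhoM morita_inE !linearZ.
apply: rho_inj => p'; rewrite !rhoM !morita_inE linearZ /= linearZ.
by rewrite -[X in (X * r') *: _]/(_ * morita_out m n' s) !mulrA.
Qed.

(** Let [c] be the cokernel map of [fmor G f]. Applying [F] gives a map [F c] that vanishes after
    [F (G f)], which is surjective like [f]; so [F c] is zero, and [c] is zero by faithfulness. *)
Lemma fmor_surjective (V : lmodType S) (f : {linear SS -> V}) :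
  (forall v, exists x, f x = v) -> forall w, exists p, fmor G f p = w.
Proof.
move=> f_surj; pose im := [set w | exists p, fmor G f p = w].
have sub_im : submodule im.
  split; first by exists 0; rewrite linear0.
  by move=> a _ _ [p <-] [q <-]; exists (a *: p + q); rewrite linearP.
pose C : lmodType R := quotient_module sub_im.
pose c : {linear G V -> C} := @qmod_pi R (G V) im sub_im.
suff c0 : c =1 \0%R by move=> w; apply/(qmod_pi_eq0 sub_im)/c0.
apply: F_inj => y; rewrite [RHS]fmor0 //.
have [e _ eK] := eps_bij V; have [x xE] := f_surj (e y).
rewrite -(eK y) -xE; have /= -> := epsE f x.
rewrite -[LHS]/((fmor F c \o fmor F (fmor G f)) (eps SS x)) -fmor_comp fmor0 //.
by move=> p; apply/qmod_pi_eq0; exists p.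
Qed.

(* Otherwise a nonzero map R -> G (S / J) lifts to R -> G S, that is, a nonzero
   map F R -> S / J lifts to h : F R -> S; every composite of h with a map
   S -> F R is multiplication by an element of J, so h has image in J. *)
Lemma morita_in_nontrivial (J : set S) : ideal J -> ~ J 1 ->
  exists h p r, ~ J (morita_in h p r).
Proof.
move=> [J0 JD JM _] nJ1; apply: contrapT => nJ.
have {}nJ h p r : J (morita_in h p r).
  by apply: contrapT => hpr; apply: nJ; exists h, p, r.
have sJ : @submodule S SS J.
  by split=> // a u v Ju Jv; apply: JD => //; apply: JM.
pose V : lmodType S := quotient_module sJ.
pose pi : {linear SS -> V} := @qmod_pi S SS J sJ.
have [v v0] : exists v : G V, v <> 0.
  apply: contrapT => /forallNP GV0; apply: nJ1; apply/(qmod_pi_eq0 sJ).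
  apply: (bij_inj (eps_bij V)); rewrite linear0.
  rewrite -[LHS](@fmor_id _ _ _ F (G V)) fmor0 // => w.
  by apply: contrapT; apply: GV0.
have [p0 p0E] := fmor_surjective (f := pi) (@qmod_pi_surj S SS J sJ) v.
pose g : {linear RR -> P} := @orbit_map R P p0.
have [eps' _ eps'K] := linear_inverse (eps_bij SS).
have [eta' _ eta'K] := linear_inverse (eta_bij RR).
pose h : {linear F RR -> SS} := eps' \o fmor F g.
have Jh q : J (h q).
  pose oq : {linear SS -> F RR} := @orbit_map S (F RR) q.
  pose d : dual := eta' \o fmor G oq.
  have <- : morita_in d (fmor G h (eta RR 1)) 1 = h q; last exact: nJ.
  apply: rho_inj => p; rewrite morita_inE mulr1.
  have -> : rho (h q) p = fmor G h (fmor G oq p).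
    rewrite -[RHS]/((fmor G h \o fmor G oq) p) -fmor_comp; apply: fmor_ext => x.
    by rewrite /= /orbit_map -!linearZ.
  rewrite -[fmor G oq p]eta'K -/(d p) -!linearZ; congr (fmor G h (eta RR _)).
  by rewrite -[LHS]/(_ * 1) mulr1.
apply: v0; rewrite -p0E.
suff Gpi_g : fmor G pi \o g =1 \0%R.
  by have := Gpi_g 1; rewrite /= /orbit_map scale1r.
apply: F_inj => q; rewrite [RHS]fmor0 // fmor_comp /=.
have -> : fmor F g q = eps SS (h q) by rewrite /= eps'K.
have pih : pi (h q) = 0 by apply/(qmod_pi_eq0 sJ).
transitivity (eps V (pi (h q))); last by rewrite pih linear0.
exact/esym/epsE.
Qed.

End MoritaEquivalence.

Lemma morita_dixmier_moeglin (k : fieldType) (R S : algType k) :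
  left_noetherian S -> morita_equivalent R S ->
  dixmier_moeglin R -> dixmier_moeglin S.
Proof.
move=> noethS [F [G [[eta [eta_bij etaE]] [eps [eps_bij epsE]]]]] dmR.
apply/dixmier_moeglinP => // J pJ.
have [TT' T'T] := morita_context eta_bij etaE eps_bij epsE.
apply: (contraction_dixmier_moeglin TT' T'T) => //.
  by apply/dixmier_moeglinP => //; exact: dmR.1.
have /prime_idealP[iJ nJ1 _] := pJ.
exact: morita_in_nontrivial iJ nJ1.
Qed.

Lemma morita_equivalent_sym (k : fieldType) (R S : algType k) :
  morita_equivalent R S -> morita_equivalent S R.
Proof. by move=> [F [G [FG GF]]]; exists G, F. Qed.

(** * Tensor products *)

Section TensorSpan.
Variables (k : fieldType) (R S T : algType k).

Definition zero_form (V : lmodType k) (r : R) (s : S) : V := 0.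

Lemma zero_form_bilinear (V : lmodType k) :
  bilinear_for *:%R *:%R (@zero_form V).
Proof. by split=> ? ? ? ? /=; rewrite /zero_form scaler0 addr0. Qed.

HB.instance Definition _ (V : lmodType k) := bilinear_isBilinear.Build k
  R S V *:%R *:%R (@zero_form V) (@zero_form_bilinear V).

(** The projection to [T / W] and the zero map both extend the zero bilinear form, so they agree. *)
Lemma tensor_product_span (i : {lrmorphism R -> T}) (j : {lrmorphism S -> T}) :
  tensor_product i j ->
  forall W : set T, submodule W -> (forall r s, W (i r * j s)) -> forall t, W t.
Proof.
move=> [_ univ] W sW Wij t; pose V : lmodType k := quotient_module sW.
have [f [_ f_uniq]] := univ V (@zero_form V).
apply/(qmod_pi_eq0 sW).
have pif : @qmod_pi k T W sW t = f t.
  by apply: (f_uniq (@qmod_pi k T W sW)) => r s; apply/qmod_pi_eq0.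
by rewrite pif -(f_uniq \0%R).
Qed.

End TensorSpan.

(** * Contraction of primes to a tensor factor *)

Section CommutingSpan.
Variables (k : fieldType) (R S T : algType k).
Variables (i : {lrmorphism R -> T}) (j : {lrmorphism S -> T}).
Hypothesis ijC : forall r s, i r * j s = j s * i r.
Hypothesis ij_span : forall W : set T,
  submodule W -> (forall r s, W (i r * j s)) -> forall t, W t.
Implicit Types (P I : set T) (x y z w t : T).

Lemma span_cong I x y z w : ideal I ->
  (forall r s, I (x * (i r * j s) * y - z * (i r * j s) * w)) ->
  forall t, I (x * t * y - z * t * w).
Proof.
move=> iI; apply: (ij_span (W := [set t | I (x * t * y - z * t * w)])).
split=> [|b t u /= It Iu]; first by rewrite /= !(mulr0, mul0r) subrr; have [] := iI.
have -> : x * (b *: t + u) * y - z * (b *: t + u) * w =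
    b *: (x * t * y - z * t * w) + (x * u * y - z * u * w).
  by rewrite !(mulrDr, mulrDl) -!(scalerAr, scalerAl) scalerBr opprD addrACA.
by have [_ ID _ _] := iI; apply: ID => //; apply: idealZ.
Qed.

Lemma span_ideal I x y : ideal I ->
  (forall r s, I (x * (i r * j s) * y)) -> forall t, I (x * t * y).
Proof.
move=> iI Ixy t; have := @span_cong I x y 0 0 iI.
rewrite -[X in _ -> I X]subr0 => h; have := h _ t; rewrite !mul0r; apply=> r s.
by rewrite !mul0r subr0.
Qed.

Lemma span_sandwich a r b s : i a * (i r * j s) * i b = i (a * r * b) * j s.
Proof. by rewrite !rmorphM -!mulrA ijC. Qed.

Lemma preimage_prime P : prime_ideal P -> prime_ideal (i @^-1` P).
Proof.
move=> pP; have [iP P1 mP] := (prime_idealP P).1 pP.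
have [P0 PD PM PMr] := iP; apply/prime_idealP; split.
- split; rewrite /= ?raddf0 // => x y; rewrite ?raddfD ?rmorphM.
  + exact: PD.
  + exact: PM.
  + exact: PMr.
- by rewrite /= rmorph1.
- move=> a b ab; apply: mP; apply: span_ideal => // r s.
  by rewrite span_sandwich; apply: PMr; apply: ab.
Qed.

Lemma preimage_progression P s a n v : ideal P ->
  progression (i @^-1` P) s a n v ->
  progression P (i s) (i a) n (fun l => i (v l)).
Proof.
move=> iP pv l ln; apply: span_cong => // r z.
rewrite !span_sandwich -mulrBl -raddfB.
by have [_ _ _ PMr] := iP; apply: PMr; apply: pv.
Qed.

(** The ratio [i a / i s] has a polynomial relation in [T]; by [progression_root] the image of any
    progression chosen in [R] satisfies it as well. *)
Lemma preimage_algebraic_centroid P : prime_ideal P ->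
  algebraic_centroid P -> algebraic_centroid (i @^-1` P).
Proof.
move=> pP algP s a nPs sa; have [iP _ _] := pP.
have [||n [c [u [nc pu nPu cu]]]] := algP (i s) (i a) => //.
  apply: span_cong => // r z; rewrite !span_sandwich -mulrBl -raddfB.
  by have [_ _ _ PMr] := iP; apply: PMr; apply: sa.
have [ip _ _] := preimage_prime pP.
have [v pv nPv] := progression_exists (preimage_prime pP) nPs n ip sa.
have {}pv : progression (i @^-1` P) s a n v by move=> l ln; apply/pv/leqW.
exists n, c, v; split=> //.
have := progression_root pP nPs pu nPu cu (preimage_progression iP pv).
congr P; rewrite raddf_sum; apply: eq_bigr => l _ /=; by rewrite linearZ.
Qed.

Lemma span_prime P a b : prime_ideal P -> P (i a * j b) -> P (i a) \/ P (j b).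
Proof.
move=> pP Pab; have [iP _ mP] := (prime_idealP P).1 pP.
apply: mP; apply: span_ideal => // r s.
have -> : i a * (i r * j s) * j b = j s * (i a * j b) * i r.
  have -> : i a * (i r * j s) * j b = i a * (i r * j (s * b)).
    by rewrite rmorphM !mulrA.
  by rewrite ijC rmorphM !mulrA (ijC a s).
by have [_ _ PM PMr] := iP; apply/PMr/PM.
Qed.

Definition span_sum (l : seq (R * S)) : T := \sum_(ab <- l) i ab.1 * j ab.2.

Lemma span_sumP t : exists l, t = span_sum l.
Proof.
apply: (ij_span (W := [set t | exists l, t = span_sum l])) => [|r s].
  split; first by exists [::]; rewrite /span_sum big_nil.
  move=> b _ _ [l1 ->] [l2 ->].
  exists ([seq (b *: ab.1, ab.2) | ab <- l1] ++ l2).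
  rewrite /span_sum big_cat big_map scaler_sumr; congr (_ + _).
  by apply: eq_bigr => ab _; rewrite linearZ /= scalerAl.
by exists [:: (r, s)]; rewrite /span_sum big_seq1.
Qed.

(** Only the [R]-factors change, and a term with [R]-factor [a] vanishes; this is what shortens sums
    in [prime_lying_over_eq]. *)
Lemma span_sum_commutator a r l :
  span_sum l * i r * i a - i a * i r * span_sum l =
  span_sum [seq (ab.1 * r * a - a * r * ab.1, ab.2) | ab <- l].
Proof.
rewrite /span_sum big_map !mulr_suml mulr_sumr -sumrB; apply: eq_bigr => -[b s] _ /=.
rewrite rmorphB !rmorphM mulrBl; congr (_ - _); last by rewrite !mulrA.
by rewrite -(mulrA (i b)) -(ijC r) !mulrA -(mulrA _ (j s)) -(ijC a) !mulrA.
Qed.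

End CommutingSpan.

(** * Primes with the same traces on both factors *)

Section TensorPrimes.
Variables (k : fieldType) (R S T : algType k).
Variables (i : {lrmorphism R -> T}) (j : {lrmorphism S -> T}).
Hypothesis ijC : forall r s, i r * j s = j s * i r.
Hypothesis ij_span : forall W : set T,
  submodule W -> (forall r s, W (i r * j s)) -> forall t, W t.
Implicit Types (P : set T) (t : T).

Lemma span_sum_commutator_r b s (l : seq (R * S)) :
  span_sum i j l * j s * j b - j b * j s * span_sum i j l =
  span_sum i j [seq (ab.1, ab.2 * s * b - b * s * ab.2) | ab <- l].
Proof.
rewrite /span_sum big_map !mulr_suml mulr_sumr -sumrB; apply: eq_bigr => -[a c] _ /=.
rewrite rmorphB !rmorphM mulrBr; congr (_ - _); first by rewrite !mulrA.
by rewrite !mulrA (ijC a b) -(mulrA (j b) (i a)) (ijC a s) !mulrA.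
Qed.

(* The elements of P1 outside P with the fewest summands i a * j b are, modulo
   P, multiples of their leading term by an element of the extended centroid
   of T / P. A polynomial relation for that element, with nonzero constant
   coefficient, then puts the leading term in P1. *)
Lemma prime_lying_over_eq P P1 : prime_ideal P -> prime_ideal P1 ->
  algebraic_centroid P -> P `<=` P1 ->
  i @^-1` P1 `<=` i @^-1` P -> j @^-1` P1 `<=` j @^-1` P -> P1 `<=` P.
Proof.
move=> pP pP1 algP PP1 iP1 jP1.
have [iP _ mP] := (prime_idealP P).1 pP; have [P0 PD PM PMr] := iP.
have [idP1 _ mP1] := (prime_idealP P1).1 pP1.
suff main n l : (size l <= n)%N -> P1 (span_sum i j l) -> P (span_sum i j l).
  by move=> t; have [l ->] := span_sumP ij_span t; apply: main (leqnn _).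
elim: n l => [|n IHn] [|[a b] l] //=; rewrite ?ltnS => ln P1t.
- by rewrite /span_sum big_nil.
- by rewrite /span_sum big_nil.
set t := span_sum _ _ _ in P1t *; apply: contrapT => nPt.
have tE : t = i a * j b + span_sum i j l by rewrite /t /span_sum big_cons.
have nPab : ~ P (i a * j b).
  move=> Pab; apply: nPt; rewrite tE; apply: PD => //; apply: IHn => //.
  have -> : span_sum i j l = t - i a * j b by rewrite tE addrAC subrr add0r.
  by apply: idealB => //; apply: PP1.
have nPa : ~ P (i a) by move=> Pa; apply: nPab; apply: PMr.
have nPb : ~ P (j b) by move=> Pb; apply: nPab; apply: PM.
have nP1ab : ~ P1 (i a * j b).
  by move=> /(span_prime ijC ij_span pP1)[/iP1|/jP1].
have P1comm x y : P1 (t * x * y - y * x * t).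
  have [_ _ P1M P1Mr] := idP1.
  by apply: idealB => //; [do 2!apply: (P1Mr)|apply: (P1M)].
(* The commutator lies in [P1] and its leading term is zero, so the induction hypothesis puts it in
   [P]. *)
have comm_a x : P (t * i x * i a - i a * i x * t).
  have := P1comm (i x) (i a); rewrite /t span_sum_commutator //=.
  rewrite /span_sum big_cons /= subrr raddf0 mul0r add0r; apply: IHn.
  by rewrite size_map.
have comm_b y : P (t * j y * j b - j b * j y * t).
  have := P1comm (j y) (j b); rewrite /t span_sum_commutator_r //=.
  rewrite /span_sum big_cons /= subrr raddf0 mulr0 add0r; apply: IHn.
  by rewrite size_map.
have ct : proportional P (i a * j b) t.
  move=> x; have := @span_cong _ _ _ _ i j ij_span P t (i a * j b) (i a * j b) t iP.
  apply=> r s; apply: (cong_trans iP (y := i a * i r * t * (j s * j b))).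
    have -> : t * (i r * j s) * (i a * j b) = t * i r * i a * (j s * j b).
      by rewrite !mulrA -(mulrA _ (j s)) -ijC !mulrA.
    exact: congMr.
  have -> : i a * i r * t * (j s * j b) = i a * i r * (t * j s * j b).
    by rewrite !mulrA.
  have -> : i a * j b * (i r * j s) * t = i a * i r * (j b * j s * t).
    by rewrite !mulrA -(mulrA _ (j b)) -ijC !mulrA.
  exact: congMl.
have [n0 [c [u [c0 pu nPu cu]]]] :=
  algebraic_ratio_neq0 pP nPt (algP _ _ nPab ct).
(* The progression holds modulo [P] but starts outside [P1]. Its later terms fall into [P1] with
   [t], which isolates the constant term of the relation. *)
have [v pv nP1v] := progression_exists pP1 nP1ab n0 iP ct.
have P1v l0 : (l0 < n0)%N -> P1 (v l0.+1).
  move=> l0n; apply: (prime_cancel pP1 nP1ab) => x.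
  have [_ _ P1M _] := idP1.
  by apply: (ideal_subK idP1 (y := v l0 * x * t)); [apply/PP1/pv|apply: P1M].
apply: nP1v; have := PP1 _ (progression_root pP nPab pu nPu cu pv).
rewrite big_ord_recl => P1cv.
have : P1 (c 0%N *: v 0%N).
  rewrite -[_ *: _](addrK (\sum_(m < n0) c (lift ord0 m) *: v (lift ord0 m))).
  apply: idealB => //; apply: ideal_sum => // m _; apply: idealZ => //.
  exact: P1v.
by move=> /(idealZ (c 0%N)^-1 idP1); rewrite scalerA mulVf // scale1r.
Qed.

(** With [r] and [s] witnesses for the two traces of [P], some [i r * x * j s] outside [P] is a
    witness for [P]: by [prime_lying_over_eq] a prime strictly above [P] has a strictly larger trace
    on [R] or on [S], hence contains [i r] or [j s]. *)
Lemma tensor_locally_closed P :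
  (forall p : set R, prime_ideal p -> algebraic_centroid p ->
    locally_closed_ideal p) ->
  (forall q : set S, prime_ideal q -> algebraic_centroid q ->
    locally_closed_ideal q) ->
  prime_ideal P -> algebraic_centroid P -> locally_closed_ideal P.
Proof.
move=> lcR lcS pP algP.
have jiC s r : j s * i r = i r * j s by [].
have ji_span (W : set T) :
    submodule W -> (forall s r, W (j s * i r)) -> forall t, W t.
  by move=> sW Wji; apply: ij_span => // r s; rewrite ijC.
have [r nPr hr] : locally_closed_ideal (i @^-1` P).
  apply: lcR; first exact: preimage_prime ijC ij_span _ _.
  exact: preimage_algebraic_centroid ijC ij_span _ _ _.
have [s nPs hs] : locally_closed_ideal (j @^-1` P).
  apply: lcS; first exact: preimage_prime jiC ji_span _ _.
  exact: preimage_algebraic_centroid jiC ji_span _ _ _.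
have [x nPx] := prime_mulP pP nPr nPs.
exists (i r * x * j s) => // Q pQ PQ nQP.
have [[_ _ QM QMr] _ _] := pQ.
have [Qi|nQi] := pselect (i @^-1` Q `<=` i @^-1` P); last first.
  do 2!apply: (QMr); apply: (hr (i @^-1` Q)) => //.
    exact: preimage_prime ijC ij_span _ _.
  by move=> z; apply: PQ.
have [Qj|nQj] := pselect (j @^-1` Q `<=` j @^-1` P); last first.
  apply: QM; apply: (hs (j @^-1` Q)) => //.
    exact: preimage_prime jiC ji_span _ _.
  by move=> z; apply: PQ.
by case: nQP; apply: prime_lying_over_eq.
Qed.

End TensorPrimes.

(** * Consequences of the Nullstellensatz *)

Section Nullstellensatz.
Variables (k : fieldType) (T : algType k).
Hypothesis nullT : nullstellensatz T.

(** [P] is an intersection of primitive ideals, one of which misses the witness [r]; it cannot lie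
    strictly above [P]. *)
Lemma nullstellensatz_primitive (P : set T) :
  prime_ideal P -> locally_closed_ideal P -> primitive_ideal P.
Proof.
move=> pP [r nPr hr]; have [F primF PE] := nullT.1 P pP.
have [I FI nIr] : exists2 I, F I & ~ I r.
  apply: contrapT => h; apply: nPr; rewrite PE => I FI.
  by apply: contrapT => nIr; apply: h; exists I.
suff -> : P = I by apply: primF.
have PI : P `<=` I by rewrite PE => x; apply.
apply/seteqP; split=> //; apply: contrapT => nIP; apply: nIr.
by apply: hr => //; apply/primitive_ideal_prime/primF.
Qed.

(** The ratio [a / s] acts on the simple module as an endomorphism [f] with [f (r s m) = r a m]. A
    polynomial that kills [f] gives the relation, since [u l] acts as [u 0] followed by [l]
    iterations of [f]. *)
Lemma nullstellensatz_algebraic_centroid (P : set T) :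
  primitive_ideal P -> algebraic_centroid P.
Proof.
move=> primP; have pP := primitive_ideal_prime primP.
have [M sM PE] := primP; have genM := simple_module_generator sM.
move=> s a nPs sa; have [iP _ _] := pP.
have [m0 sm0] : exists m : M, s *: m <> 0.
  apply: contrapT => /forallNP h; apply: nPs; rewrite PE => m.
  by apply: contrapT; apply: h.
have aM x (m : M) : a *: (x *: (s *: m)) = s *: (x *: (a *: m)).
  have := sa x; rewrite PE => /(_ m).
  rewrite scalerBl => /eqP; rewrite subr_eq0 => /eqP.
  by rewrite !scalerA.
(* This makes [f] well defined: if [r a m0] were nonzero, then [m0 = y r a m0] for some [y], and
   [s m0 = s y r a m0 = a y r s m0 = 0]. *)
have wd0 (r : T) : r *: (s *: m0) = 0 -> r *: (a *: m0) = 0.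
  move=> rs; apply: contrapT => w0; apply: sm0.
  have [y ->] := genM _ w0 m0.
  have := aM (y * r) m0; rewrite -!scalerA rs !scaler0 => <- //.
have [g gE] := choice (genM _ sm0).
pose F m : M := g m *: (a *: m0).
have FE (r : T) : F (r *: (s *: m0)) = r *: (a *: m0).
  apply/eqP; rewrite -subr_eq0 -scalerBl; apply/eqP/wd0.
  by rewrite scalerBl -gE subrr.
have linF : linear F.
  move=> b u v; rewrite [in LHS](gE u) [in LHS](gE v) scalerA -scalerDl FE.
  by rewrite scalerDl -scalerA.
pose f : {linear M -> M} := HB.pack F (GRing.isLinear.Build T M M *:%R F linF).
have fE (r : T) (m : M) : f (r *: (s *: m)) = r *: (a *: m).
  rewrite (gE m) -[LHS]/(F _).
  have -> : r *: (s *: (g m *: (s *: m0))) = (r * s * g m) *: (s *: m0).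
    by rewrite -!scalerA.
  by rewrite FE -!scalerA -aM.
have [p p0 pf] := nullT.2 M sM f; pose n := size p.
have [u pu nPu] := progression_exists pP nPs n iP sa.
have uE l (m : M) : (l <= n)%N -> u l *: m = iter l f (u 0%N *: m).
  elim: l m => // l IHl m ln; rewrite iterS -IHl; last exact: ltnW.
  rewrite (gE m); have := pu l ln (g m); rewrite PE => /(_ m0).
  rewrite scalerBl => /eqP; rewrite subr_eq0 -!scalerA => /eqP ->.
  by rewrite [u l *: _]scalerA fE scalerA.
exists n, (fun l => p`_l), u; split=> //.
- exists n.-1; first by rewrite prednK ?leqnn // lt0n size_poly_eq0.
  by rewrite -lead_coefE lead_coef_eq0.
- by move=> l ln; apply/pu/leqW.
- rewrite PE => m; rewrite scaler_suml -[RHS](pf (u 0%N *: m)).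
  apply: eq_bigr => l _; rewrite -uE; last exact: ltnW.
  by rewrite scalerA mulr_algl.
Qed.

End Nullstellensatz.

Lemma tensor_dixmier_moeglin (k : fieldType) (R S T : algType k)
    (i : {lrmorphism R -> T}) (j : {lrmorphism S -> T}) :
  dixmier_moeglin R -> dixmier_moeglin S -> tensor_product i j ->
  left_noetherian T -> nullstellensatz T -> dixmier_moeglin T.
Proof.
move=> dmR dmS tij noethT nullT; apply/dixmier_moeglinP => // P pP.
have acl (A : algType k) (p : set A) : dixmier_moeglin A -> prime_ideal p ->
    algebraic_centroid p -> locally_closed_ideal p.
  move=> dmA pp; have [|lp pa] := (dixmier_moeglinP _).1 dmA p pp.
    exact: dmA.1.
  by move=> /pa/lp.
have lc_pr := nullstellensatz_primitive nullT pP.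
have pr_ac := @nullstellensatz_algebraic_centroid _ _ nullT P.
have ac_lc : algebraic_centroid P -> locally_closed_ideal P.
  apply: (tensor_locally_closed tij.1 (tensor_product_span tij)) => // p;
    exact: acl.
by split; split; auto.
Qed.

Theorem theorem1p3 (k : fieldType) (R S : algType k)
    (hR : left_noetherian R) (hS : left_noetherian S) :
  (morita_equivalent R S -> (dixmier_moeglin R <-> dixmier_moeglin S)) /\
  (dixmier_moeglin R ->
     forall (e : R) (e_idem : e * e = e) (e_neq0 : e != 0),
       dixmier_moeglin (corner e_idem e_neq0)) /\
  (dixmier_moeglin R -> dixmier_moeglin S ->
     forall (T : algType k) (i : {lrmorphism R -> T}) (j : {lrmorphism S -> T}),
       tensor_product i j -> left_noetherian T -> nullstellensatz T ->
       dixmier_moeglin T).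
Proof.
split=> [RS|]; [split|split].
- exact: morita_dixmier_moeglin.
- exact/morita_dixmier_moeglin/morita_equivalent_sym.
- by move=> dmR e e_idem e_neq0; apply: corner_dixmier_moeglin.
- by move=> dmR dmS T i j; apply: tensor_dixmier_moeglin.
Qed.
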